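(* Let $(M,\xi)$ be a closed cooriented contact manifold and let $\tilde{\phi}_t^{\alpha}$ be the lift to $\widetilde{\mathcal{G}}(M,\xi)$ of the Reeb flow at time $t$ of some contact form $\alpha$ for $\xi$. If $|\tilde{\phi}_t^{\alpha}|_{\alpha}<|t|$ for some $t\in\mathbb{R}$, then $(M,\xi)$ is non-orderable, i.e., there exists a positive contractible loop in $\mathcal{G}(M,\xi)$.
   Context: Contact forms $\alpha$ with $\ker\alpha=\xi$ induce the given coorientation. $\mathcal{G}=\mathrm{Cont}_0(M,\xi)$ is the identity component of the group of (compactly supported) contactomorphisms, and $\widetilde{\mathcal G}$ its universal cover, i.e. homotopy classes with fixed endpoints of paths in $\mathcal G$ starting at $\mathrm{id}$. $\tilde\phi^\alpha_t\in\widetilde{\mathcal G}$ is the class of the path of Reeb flow maps $\phi^\alpha_s$, $s$ running from $0$ to $t$. The contact Hofer length of a path is $l_\alpha((\phi_s)_{s\in[0,1]})=\int_0^1\max_M|\alpha(\frac{d}{ds}\phi_s)|\,ds$, and for $\tilde\phi\in\widetilde{\mathcal G}$, $|\tilde\phi|_\alpha$ is the infimum of $l_\alpha$ over paths in the class $\tilde\phi$. Write $\tilde\phi\preccurlyeq\tilde\psi$ if $\tilde\phi^{-1}\tilde\psi$ is represented by a path $(f_t)_{t\in[0,1]}$ in $\mathcal G$ with $\alpha(\frac{d}{dt}f_t)\ge 0$ for all $t$. $(M,\xi)$ is orderable if $\preccurlyeq$ is a partial order on $\widetilde{\mathcal G}$, and non-orderable otherwise. A loop $(f_t)$ in $\mathcal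 G$ is positive if $\alpha(\frac{d}{dt}f_t)>0$ everywhere. It is known (Eliashberg–Polterovich) that a closed contact manifold is non-orderable if and only if there is a contractible positive loop in $\mathcal G$. *)

(* Defs.v *)
From HB Require Import structures.
From mathcomp Require Import all_boot all_order all_algebra.
From mathcomp Require Import all_classical all_reals all_analysis.
Set Implicit Arguments.
Unset Strict Implicit.
Unset Printing Implicit Defensive.
Import Order.TTheory GRing.Theory Num.Theory.
Import numFieldNormedType.Exports.
Local Open Scope classical_set_scope.
Local Open Scope ring_scope.

(* C^k on the open set U. Used for finite-dimensional V only, where the
   differential is C^k iff each x |-> 'd f x v is. *)
Fixpoint Ck (R : realType) (k : nat) (V W : normedModType R) (U : set V)
    (f : V -> W) : Prop :=
  if k is k'.+1 then
    (forall x, U x -> differentiable f x) /\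
    (forall v : V, Ck k' U (fun x => 'd f x v))
  else forall x, U x -> {for x, continuous f}.

Definition Cinf (R : realType) (V W : normedModType R) (U : set V)
  (f : V -> W) : Prop := forall k, Ck k U f.

(* chart_inv is meaningful on chart_map @` chart_dom only, chart_map on
   chart_dom only. *)
Record chart (R : realType) (m : nat) (M : topologicalType) := Chart {
  chart_dom : set M;
  chart_map : M -> 'rV[R]_m;
  chart_inv : 'rV[R]_m -> M;
  chart_dom_open : open chart_dom;
  chart_im_open : open (chart_map @` chart_dom);
  chart_mapK : forall x, chart_dom x -> chart_inv (chart_map x) = x;
  chart_map_cont : forall x, chart_dom x -> {for x, continuous chart_map};
  chart_inv_cont : forall p, (chart_map @` chart_dom) p ->
    {for p, continuous chart_inv} }.

Definition chart_im (R : realType) (m : nat) (M : topologicalType)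
  (c : chart R m M) : set 'rV[R]_m := chart_map c @` chart_dom c.

(* Compact and without boundary; second countability follows from compactness.
   Connectedness is not required. *)
Record closedManifold (R : realType) (m : nat) := ClosedManifold {
  mfd_sort :> topologicalType;
  mfd_nonempty : [set: mfd_sort] !=set0;
  mfd_hausdorff : hausdorff_space mfd_sort;
  mfd_compact : compact [set: mfd_sort];
  atlas : set (chart R m mfd_sort);
  atlas_cover : forall x, exists c, atlas c /\ chart_dom c x;
  atlas_compat : forall c d, atlas c -> atlas d ->
    Cinf (chart_map c @` (chart_dom c `&` chart_dom d))
         (chart_map d \o chart_inv c) }.

(* A preferred chart around x. Throughout, the tangent space T_x M is 'rV_m,
   its elements being coordinates in chart_at x. *)
Definition chart_at (R : realType) (m : nat) (M : closedManifold R m) (x : M) :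
  chart R m M := proj1_sig (cid (atlas_cover x)).

(* Smoothness on A * M of (s, x) |-> F s x, for a family of self-maps of M with
   parameter s in P. When A is not open, F itself has to be smooth on a
   neighbourhood of A * M. *)
Definition smooth_family (R : realType) (m : nat) (M : closedManifold R m)
    (P : normedModType R) (A : set P) (F : P -> M -> M) : Prop :=
  forall s x (c d : chart R m M), A s -> atlas c -> atlas d ->
    chart_dom c x -> chart_dom d (F s x) ->
    exists U : set (P * 'rV[R]_m)%type,
      [/\ open U, U (s, chart_map c x),
          forall q, U q -> chart_im c q.2 /\
                           chart_dom d (F q.1 (chart_inv c q.2))
        & Cinf U (fun q => chart_map d (F q.1 (chart_inv c q.2)))].

Definition smooth_map (R : realType) (m : nat) (M : closedManifold R m)
  (f : M -> M) : Prop := smooth_family [set: R^o] (fun=> f).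

(* df_x : T_x M -> T_{f x} M *)
Definition tangent_map (R : realType) (m : nat) (M : closedManifold R m)
    (f : M -> M) (x : M) (v : 'rV[R]_m) : 'rV[R]_m :=
  'd (fun p => chart_map (chart_at (f x)) (f (chart_inv (chart_at x) p)))
     (chart_map (chart_at x) x) v.

(* (d/ds f_s)(x), in the tangent space at f_s(x) *)
Definition velocity (R : realType) (m : nat) (M : closedManifold R m)
    (f : R -> M -> M) (s : R) (x : M) : 'rV[R]_m :=
  derive1 (fun u : R => chart_map (chart_at (f s x)) (f u x)) s.

Definition oneForm (R : realType) (m : nat) (M : closedManifold R m) :=
  M -> {linear 'rV[R]_m -> R^o}.

(* Value of the form on the vector with coordinates v in the chart c, at the
   point with coordinates p in c. *)
Definition form_in_chart (R : realType) (m : nat) (M : closedManifold R m)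
    (alpha : oneForm M) (c : chart R m M) (p v : 'rV[R]_m) : R^o :=
  let x := chart_inv c p in
  alpha x ('d (fun q => chart_map (chart_at x) (chart_inv c q)) p v).

Definition smooth_form (R : realType) (m : nat) (M : closedManifold R m)
    (alpha : oneForm M) : Prop :=
  forall c, atlas c -> forall v : 'rV[R]_m,
    Cinf (chart_im c) (fun p => form_in_chart alpha c p v).

(* d alpha (v, w) = v(alpha(w)) - w(alpha(v)), with v and w extended as constant
   vector fields in the chart chart_at x *)
Definition dform (R : realType) (m : nat) (M : closedManifold R m)
    (alpha : oneForm M) (x : M) (v w : 'rV[R]_m) : R :=
  let c := chart_at x in
  let p := chart_map c x in
  'd (fun q => form_in_chart alpha c q w) p v
  - 'd (fun q => form_in_chart alpha c q v) p w.

(* alpha is a contact form (alpha /\ (d alpha)^n vanishes nowhere, i.e. d alpha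
   is nondegenerate on ker alpha) whose kernel is the field xi and which is
   positive exactly on the vectors of pos. *)
Definition contact_form_for (R : realType) (n : nat)
    (M : closedManifold R n.*2.+1) (xi pos : M -> set 'rV[R]_(n.*2.+1))
    (alpha : oneForm M) : Prop :=
  [/\ smooth_form alpha,
      forall x, exists v, alpha x v != 0,
      forall x v, alpha x v = 0 -> v != 0 ->
        exists w, alpha x w = 0 /\ dform alpha x v w != 0,
      forall x v, xi x v <-> alpha x v = 0
    & forall x v, pos x v <-> 0 < alpha x v].

(* The coorientation of xi is given by its positive transverse vectors. *)
Record closedContactManifold (R : realType) (n : nat) := ClosedContactManifold {
  contact_mfd :> closedManifold R n.*2.+1;
  xi : contact_mfd -> set 'rV[R]_(n.*2.+1);
  copos : contact_mfd -> set 'rV[R]_(n.*2.+1);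
  xi_contact : exists alpha, contact_form_for xi copos alpha }.

Definition contact_form (R : realType) (n : nat)
    (M : closedContactManifold R n) (alpha : oneForm M) : Prop :=
  contact_form_for (@xi R n M) (@copos R n M) alpha.

Definition is_inverse (T : Type) (f g : T -> T) : Prop :=
  cancel f g /\ cancel g f.

Definition contactomorphism (R : realType) (n : nat)
    (M : closedContactManifold R n) (f : M -> M) : Prop :=
  [/\ smooth_map f,
      exists g : M -> M, smooth_map g /\ is_inverse f g
    & forall x v, xi x v <-> xi (f x) (tangent_map f x v)].

Definition unit_itv (R : realType) : set R^o := `[0, 1].

(* Cont_0(M, xi), as the smooth path component of the identity *)
Definition cont0 (R : realType) (n : nat) (M : closedContactManifold R n) :
    set (M -> M) :=
  [set f | exists g : R^o -> M -> M,
    [/\ smooth_family (@unit_itv R) g,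
        forall s, unit_itv s -> contactomorphism (g s),
        g 0 = id & g 1 = f]].

(* Paths in Cont_0; only their values on [0, 1] matter. *)
Definition cpath (R : realType) (n : nat) (M : closedContactManifold R n)
    (f : R -> M -> M) : Prop :=
  smooth_family (P := R^o) (@unit_itv R) f /\
  forall s, unit_itv s -> cont0 (f s).

(* Homotopy with fixed endpoints in Cont_0 of paths parametrised by [0, 1] *)
Definition homotopic (R : realType) (n : nat) (M : closedContactManifold R n)
    (f g : R -> M -> M) : Prop :=
  exists h : (R^o * R^o)%type -> M -> M,
    [/\ smooth_family (@unit_itv R `*` @unit_itv R) h,
        forall r s, unit_itv r -> unit_itv s -> cont0 (h (r, s)),
        forall s, unit_itv s -> h (0, s) = f s /\ h (1, s) = g s
      & forall r, unit_itv r -> h (r, 0) = f 0 /\ h (r, 1) = f 1].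

Definition based_cpath (R : realType) (n : nat) (M : closedContactManifold R n)
  (f : R -> M -> M) : Prop := cpath f /\ f 0 = id.

Definition hclass (R : realType) (n : nat) (M : closedContactManifold R n)
    (f : R -> M -> M) : set (R -> M -> M) :=
  [set g | based_cpath g /\ homotopic f g].

(* The universal cover of Cont_0, as a set of homotopy classes *)
Definition ucover (R : realType) (n : nat) (M : closedContactManifold R n) :
    set (set (R -> M -> M)) :=
  [set A | exists f : R -> M -> M, based_cpath f /\ A = hclass f].

Definition ucover_inv (R : realType) (n : nat) (M : closedContactManifold R n)
    (A : set (R -> M -> M)) : set (R -> M -> M) :=
  [set p | based_cpath p /\
    exists2 a, A a & forall s, unit_itv s -> is_inverse (a s) (p s)].

Definition ucover_mul (R : realType) (n : nat) (M : closedContactManifold R n)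
    (A B : set (R -> M -> M)) : set (R -> M -> M) :=
  [set p | based_cpath p /\
    exists a b, [/\ A a, B b & homotopic (fun s => a s \o b s) p]].

Definition ucover_le (R : realType) (n : nat) (M : closedContactManifold R n)
    (alpha : oneForm M) (A B : set (R -> M -> M)) : Prop :=
  exists f, ucover_mul (ucover_inv A) B f /\
    forall s x, unit_itv s -> 0 <= alpha (f s x) (velocity f s x).

(* Does not depend on the contact form alpha for the cooriented xi, since only
   the sign of alpha is used. *)
Definition orderable (R : realType) (n : nat) (M : closedContactManifold R n)
    (alpha : oneForm M) : Prop :=
  [/\ forall A, ucover A -> ucover_le alpha A A,
      forall A B, ucover A -> ucover B ->
        ucover_le alpha A B -> ucover_le alpha B A -> A = B
    & forall A B C, ucover A -> ucover B -> ucover C ->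
        ucover_le alpha A B -> ucover_le alpha B C -> ucover_le alpha A C].

(* A loop is a smooth family over the circle R / Z. *)
Definition positive_loop (R : realType) (n : nat)
    (M : closedContactManifold R n) (alpha : oneForm M) (f : R -> M -> M) :
    Prop :=
  [/\ smooth_family (P := R^o) [set: R^o] f,
      forall s, f (s + 1) = f s,
      forall s, cont0 (f s)
    & forall s x, 0 < alpha (f s x) (velocity f s x)].

Definition contractible_loop (R : realType) (n : nat)
  (M : closedContactManifold R n) (f : R -> M -> M) : Prop :=
  homotopic f (fun=> f 0).

Definition path_length (R : realType) (n : nat)
    (M : closedContactManifold R n) (alpha : oneForm M) (f : R -> M -> M) :
    \bar R :=
  (\int[lebesgue_measure]_(s in `[0%R, 1%R])
     ereal_sup [set (`|alpha (f s x) (velocity f s x) : R|)%:E |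
                 x in [set: M]])%E.

Definition hofer_norm (R : realType) (n : nat)
    (M : closedContactManifold R n) (alpha : oneForm M)
    (A : set (R -> M -> M)) : \bar R :=
  ereal_inf [set path_length alpha f | f in A].

Definition reeb_field (R : realType) (n : nat) (M : closedContactManifold R n)
    (alpha : oneForm M) (X : M -> 'rV[R]_(n.*2.+1)) : Prop :=
  forall x, alpha x (X x) = 1 /\ forall w, dform alpha x (X x) w = 0.

Definition flow_of (R : realType) (m : nat) (M : closedManifold R m)
    (X : M -> 'rV[R]_m) (phi : R -> M -> M) : Prop :=
  [/\ smooth_family (P := R^o) [set: R^o] phi,
      phi 0 = id,
      forall s t, phi (s + t) = phi s \o phi t
    & forall s x, velocity phi s x = X (phi s x)].

Definition reeb_flow (R : realType) (n : nat) (M : closedContactManifold R n)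
    (alpha : oneForm M) (phi : R -> M -> M) : Prop :=
  exists X, reeb_field alpha X /\ flow_of X phi.

(* The class of s |-> phi_s, s running from 0 to t (t may be negative) *)
Definition flow_lift (R : realType) (n : nat) (M : closedContactManifold R n)
  (phi : R -> M -> M) (t : R) : set (R -> M -> M) :=
  hclass (fun s => phi (s * t)).

(* Main.v *)
From HB Require Import structures.
Require Import Defs.
From mathcomp Require Import all_boot all_order all_algebra.
From mathcomp Require Import all_classical all_reals all_analysis.
From mathcomp Require Import measurable_realfun ring lra zify.
Set Implicit Arguments.
Unset Strict Implicit.
Unset Printing Implicit Defensive.
Import Order.TTheory GRing.Theory Num.Theory.
Import numFieldNormedType.Exports.
Local Open Scope classical_set_scope.
Local Open Scope ring_scope.

(** Let [f] be a path homotopic to the Reeb path [s |-> phi (s * t)] and shorter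
    than [|t|]. Up to the direction of time, the Reeb path runs backwards, and the
    loop is obtained by letting the Reeb flow bring [f] back to where it started:
    [phi (c s) \o f s], where the clock [c] advances by [|t|] in total. The Reeb
    flow preserves [alpha] ([reeb_pullback]), so the velocity of this loop pairs
    with [alpha] to [c' s] plus the pairing for [f], and the loop is positive as
    soon as [c'] exceeds the maximum [m s] of [|alpha (df/ds)|]. There is room for
    such a clock because the integral of [m] is less than [|t|].

    A smooth clock is found by slowing [f] down. Upper Darboux sums of [m] still
    are less than [|t|] ([upper_sum_lt]), and if the parameter of [f] pauses at the
    subdivision points, then a clock whose rate on each piece is a multiple of
    the rate of the parameter, plus a small drift, is smooth ([profile_exists]).
    Near the two ends only the drift remains; there the loop is the Reeb flow at
    small constant speed, and its periodic extension is smooth ([loop_positive]).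

    In the same way the Reeb flow can follow each path of the homotopy from the
    Reeb path to [f], with a clock that interpolates between the exact inverse of
    the Reeb path and [c] (family [reeb_twist]). This contracts the loop
    ([loop_contractible]).

    Slowing the clock further by a constant [h] below the drift keeps the row of
    [f] positive, and changes its class from that of the identity to that of
    [phi] run up to time [- h]. So the class of [phi] run up to time [h] is both
    above and below the identity; it differs from the identity, since [phi h] is
    not the identity map for some small [h], and antisymmetry fails
    ([not_orderable]).

    That [alpha] is preserved by the Reeb flow comes from the definition of the
    Reeb field and the symmetry of second derivatives ([schwarz]). The calculus
    of higher derivatives behind smooth families rests on one chain rule
    ([Ck_comp]). *)

(** * Differentiability of higher order *)

Section DiffRules.
Variables (R : realType) (V W : normedModType R).

Lemma near_is_diff (f g : V -> W) (x : V) (df : V -> W) :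
  (\forall y \near x, f y = g y) -> is_diff x f df -> is_diff x g df.
Proof.
move=> fg dff.
have e0 : is_diff x (g - f) (0 : V -> W).
  have ex : (g - f) \o shift x = cst ((g - f) x) + (0 : V -> W) +o_ (0 : V) id.
    apply/eqaddoE/eqaddoP => e e0.
    have -> : (g - f) x = 0.
      by rewrite /GRing.add /GRing.opp /= (nbhs_singleton fg) subrr.
    have : \forall h \near (0 : V), f (h + x) = g (h + x).
      by move: fg; rewrite (near_shift 0 x) /= subr0.
    apply: filterS => h fgh.
    rewrite !fctE /= fgh subrr /cst !addr0 subr0 normr0.
    by rewrite mulr_ge0// ltW.
  have c0 : continuous (0 : V -> W) by move=> ?; exact: cvg_cst.
  apply: DiffDef; last exact: diff_unique.
  apply/diff_locallyP.
  have -> : 'd (g - f) x = (0 : V -> W) :> (V -> W) by exact: diff_unique.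
  by split.
have := is_diffD e0 dff.
by rewrite subrK add0r.
Qed.

Lemma scale_is_diff (a : V -> R^o) (w : V -> W) (x : V) (da : V -> R^o)
    (dw : V -> W) :
  is_diff x a da -> is_diff x w dw ->
  is_diff x (fun y => a y *: w y) (fun v => a x *: dw v + da v *: w x).
Proof.
move=> hda hdw.
have bil : bilinear_for
    (GRing.Scale.Law.clone _ _ *:%R _) (GRing.Scale.Law.clone _ _ *:%R _)
    (fun (k : R^o) (u : W) => k *: u).
  split=> [u'|u] c y z /=; first by rewrite scalerDl scalerA.
  by rewrite scalerDr !scalerA mulrC.
pose bM := bilinear_isBilinear.Build _ _ _ _ _ _ _ bil.
pose b : {bilinear R^o -> W -> W} := HB.pack (fun (k : R^o) (u : W) => k *: u) bM.
have bc : continuous (fun p : (R^o * W)%type => b p.1 p.2).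
  by move=> p; apply: scale_continuous.
have db : is_diff (a x, w x) (fun p : (R^o * W)%type => b p.1 p.2)
    (fun q => b (a x) q.2 + b q.1 (w x)).
  apply: DiffDef; first exact: differentiable_bilin.
  exact: (diff_bilin (a x, w x) bc).
exact: (is_diff_comp (is_diff_pair hda hdw) db).
Qed.

End DiffRules.

(** Finite dimension enters through a finite frame: it expands
    [dg(f x)(df(x) v)] into products of a function of [x] with a partial
    derivative of [g] at [f x], which makes the chain rule pass to higher
    derivatives. *)
Definition has_frame (R : realType) (V : normedModType R) : Prop :=
  exists n (e : 'I_n -> V) (c : 'I_n -> {linear V -> R^o}),
    (forall i, continuous (c i)) /\ forall v, v = \sum_i c i v *: e i.

Section CkRules.
Variable R : realType.
Implicit Types (V W X : normedModType R) (k : nat).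

Lemma Ck_sub V W k (U U' : set V) (f : V -> W) :
  U' `<=` U -> Ck k U f -> Ck k U' f.
Proof.
move=> sU; elim: k f => [|k IH] f /=; first by move=> h x /sU/h.
by move=> [h1 h2]; split=> [x /sU/h1//|v]; apply: IH.
Qed.

Lemma Ck_eq V W k (U : set V) (f g : V -> W) :
  open U -> (forall x, U x -> f x = g x) -> Ck k U f -> Ck k U g.
Proof.
move=> oU; elim: k f g => [|k IH] f g fg /=.
  move=> h x Ux; have nfg : \forall y \near x, f y = g y.
    by apply: filterS (open_nbhs_nbhs (conj oU Ux)) => y /fg.
  rewrite /prop_for /continuous_at -(fg x Ux).
  by apply: cvg_trans (h x Ux); apply: near_eq_cvg.
have dfg x : U x -> differentiable f x -> is_diff x g ('d f x).
  move=> Ux /differentiableP; apply: near_is_diff.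
  by apply: filterS (open_nbhs_nbhs (conj oU Ux)) => y /fg.
move=> [h1 h2]; split=> [x Ux|v]; first by have [] := dfg x Ux (h1 x Ux).
apply: (IH (fun x => 'd f x v) _ _ (h2 v)) => x Ux.
have [_ e] := dfg x Ux (h1 x Ux); exact: (esym (congr1 (@^~ v) e)).
Qed.

Lemma CkW V W k (U : set V) (f : V -> W) : Ck k.+1 U f -> Ck k U f.
Proof.
elim: k f => [|k IH] f.
  by move=> [h _] x Ux; apply/differentiable_continuous/h.
move=> [h1 h2]; split=> // v; exact/IH/h2.
Qed.

Lemma CkS V W k (U : set V) (f : V -> W) (df : V -> V -> W) : open U ->
  (forall x, U x -> differentiable f x /\ 'd f x = df x :> (V -> W)) ->
  (forall v, Ck k U (fun x => df x v)) -> Ck k.+1 U f.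
Proof.
move=> oU hd hk; split=> [x /hd[]//|v].
by apply: Ck_eq (hk v) => // x /hd[_ ->].
Qed.

Lemma Ck_cst V W k (U : set V) (w : W) : open U -> Ck k U (fun=> w).
Proof.
move=> oU; elim: k w => [|k IH] w; first by move=> x _; exact: cvg_cst.
apply: (CkS (df := fun _ _ => 0) oU) => [x _|v]; last exact: IH.
by split; [exact: differentiable_cst|exact: (diff_cst w x)].
Qed.

Lemma Ck_lin V W k (U : set V) (l : {linear V -> W}) :
  open U -> continuous l -> Ck k U l.
Proof.
move=> oU lc; case: k => [|k]; first by move=> x _; exact: lc.
apply: (CkS (df := fun _ => l) oU) => [x _|v]; last exact: Ck_cst.
by split; [exact: linear_differentiable|exact: diff_lin].
Qed.

Lemma CkD V W k (U : set V) (f g : V -> W) :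
  open U -> Ck k U f -> Ck k U g -> Ck k U (fun x => f x + g x).
Proof.
move=> oU; elim: k f g => [|k IH] f g.
  by move=> hf hg x Ux; apply: cvgD; [exact: hf|exact: hg].
move=> [f1 f2] [g1 g2].
apply: (CkS (df := fun x v => 'd f x v + 'd g x v) oU) => [x Ux|v].
  have F := differentiableP (f1 x Ux); have G := differentiableP (g1 x Ux).
  by case: (is_diffD F G).
exact: (IH _ _ (f2 v) (g2 v)).
Qed.

Lemma Ck_sum V W k (U : set V) n (f : 'I_n -> V -> W) : open U ->
  (forall i, Ck k U (f i)) -> Ck k U (fun x => \sum_i f i x).
Proof.
move=> oU; elim: n f => [|n IH] f hf.
  by under eq_fun do rewrite big_ord0; exact: Ck_cst.
under eq_fun do rewrite big_ord_recr /=.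
by apply: CkD => //; apply: IH.
Qed.

Lemma CkZ V W k (U : set V) (a : V -> R^o) (f : V -> W) :
  open U -> Ck k U a -> Ck k U f -> Ck k U (fun x => a x *: f x).
Proof.
move=> oU; elim: k a f => [|k IH] a f.
  by move=> ha hf x Ux; apply: cvgZ; [exact: ha|exact: hf].
move=> Ha Hf; have [a1 a2] := Ha; have [f1 f2] := Hf.
apply: (CkS (df := fun x v => a x *: 'd f x v + 'd a x v *: f x) oU) => [x Ux|v].
  have F := differentiableP (f1 x Ux).
  by case: (scale_is_diff (differentiableP (a1 x Ux)) F).
apply: CkD => //; first exact: (IH _ _ (CkW Ha) (f2 v)).
exact: (IH _ _ (a2 v) (CkW Hf)).
Qed.

Lemma Ck_linr V W X k (U : set V) (l : {linear W -> X}) (f : V -> W) :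
  open U -> continuous l -> Ck k U f -> Ck k U (fun x => l (f x)).
Proof.
move=> oU lc; elim: k f => [|k IH] f.
  move=> hf x Ux; apply: (@continuous_comp _ _ _ f l); first exact: hf.
  exact: lc.
move=> [f1 f2]; apply: (CkS (df := fun x v => l ('d f x v)) oU) => [x Ux|v].
  have F := differentiableP (f1 x Ux).
  have L : is_diff (f x) l l.
    by apply: DiffDef; [exact: linear_differentiable|exact: diff_lin].
  by case: (is_diff_comp F L).
exact: (IH _ (f2 v)).
Qed.

Lemma Ck_pair V W X k (U : set V) (f : V -> W) (g : V -> X) :
  open U -> Ck k U f -> Ck k U g -> Ck k U (fun x => (f x, g x)).
Proof.
move=> oU; elim: k f g => [|k IH] f g.
  by move=> hf hg x Ux; apply: cvg_pair; [exact: hf|exact: hg].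
move=> [f1 f2] [g1 g2].
apply: (CkS (df := fun x v => ('d f x v, 'd g x v)) oU) => [x Ux|v].
  have F := differentiableP (f1 x Ux); have G := differentiableP (g1 x Ux).
  by case: (is_diff_pair F G).
exact: (IH _ _ (f2 v) (g2 v)).
Qed.

(** The chain rule gives a derivative that is again a sum of products, once the
    inner differential is expanded in a frame of the middle space. *)
Lemma Ck_comp V W X k (U : set V) (U' : set W) (f : V -> W) (g : W -> X) :
  has_frame W -> open U -> (forall x, U x -> U' (f x)) ->
  Ck k U f -> Ck k U' g -> Ck k U (fun x => g (f x)).
Proof.
move=> [n [e [c [cc ce]]]] oU fU; elim: k g => [|k IH] g.
  move=> hf hg x Ux; apply: (@continuous_comp _ _ _ f g); first exact: hf.
  exact/hg/fU.
move=> Hf [g1 g2]; have [f1 f2] := Hf.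
apply: (CkS (df := fun x v => \sum_i c i ('d f x v) *: 'd g (f x) (e i)) oU) => [x Ux|v].
  have F := differentiableP (f1 x Ux).
  have G := differentiableP (g1 _ (fU _ Ux)).
  case: (is_diff_comp F G) => GF1 GF2; split=> //; rewrite GF2.
  rewrite funeqE => v /=; rewrite [in LHS](ce ('d f x v)) linear_sum.
  by apply: eq_bigr => i _; rewrite linearZ.
apply: (Ck_sum oU) => i; apply: (CkZ oU); first exact: Ck_linr oU (cc i) (f2 v).
exact: (IH _ (CkW Hf) (g2 (e i))).
Qed.

End CkRules.

(** * Smooth families of maps of a manifold *)

Section Frames.
Variable R : realType.

Lemma has_frame_real : has_frame R^o.
Proof.
exists 1%N, (fun=> 1), (fun=> idfun); split=> [_ x|v]; first exact: cvg_id.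
by rewrite big_ord1 /= /GRing.scale /= mulr1.
Qed.

Lemma has_frame_row m : has_frame 'rV[R]_m.
Proof.
have lin i : linear (fun v : 'rV[R]_m => v ord0 i : R^o).
  by move=> a u v; rewrite !mxE.
pose c i : {linear 'rV[R]_m -> R^o} :=
  HB.pack (fun v : 'rV[R]_m => v ord0 i : R^o) (GRing.isLinear.Build _ _ _ _ _ (lin i)).
exists m, (fun i => delta_mx ord0 i), c; split=> [i|v]; first exact: coord_continuous.
by rewrite {1}(row_sum_delta v).
Qed.

Lemma has_frame_prod (V W : normedModType R) :
  has_frame V -> has_frame W -> has_frame (V * W)%type.
Proof.
move=> [n [e [c [cc ce]]]] [n' [e' [c' [cc' ce']]]].
exists (n + n')%N, (fun i : 'I_(n + n') => match fintype.split i with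
  | inl j => (e j, 0) | inr j => (0, e' j) end),
  (fun i : 'I_(n + n') => match fintype.split i with
  | inl j => (c j \o fst : {linear _ -> _})
  | inr j => (c' j \o snd : {linear _ -> _}) end); split.
  move=> i x; case: (fintype.split i) => j /=.
    by apply: (@continuous_comp _ _ _ fst (c j)); [exact: cvg_fst|exact: cc].
  by apply: (@continuous_comp _ _ _ snd (c' j)); [exact: cvg_snd|exact: cc'].
move=> [v w]; rewrite big_split_ord /=.
under eq_bigr => i _ do rewrite (unsplitK (inl i)) /=.
under [X in _ + X]eq_bigr => i _ do rewrite (unsplitK (inr i)) /=.
rewrite {1}(ce v) {1}(ce' w).
have -> : \sum_i c i v *: (e i, 0 : W) = (\sum_i c i v *: e i, 0).
  elim/big_rec2: _ => // i y1 y2 _ ->.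
  by rewrite /GRing.scale /GRing.add /= /add_pair /scale_pair /= scaler0 addr0.
have -> : \sum_i c' i w *: (0 : V, e' i) = (0, \sum_i c' i w *: e' i).
  elim/big_rec2: _ => // i y1 y2 _ ->.
  by rewrite /GRing.scale /GRing.add /= /add_pair /scale_pair /= scaler0 addr0.
by rewrite /GRing.add /= /add_pair /= addr0 add0r.
Qed.

Lemma Ck_id (V : normedModType R) k : Ck k [set: V] id.
Proof. by apply: (@Ck_lin R V V k _ idfun openT) => x; exact: cvg_id. Qed.

Lemma Ck_fst (V W : normedModType R) k : Ck k [set: (V * W)%type] (fun q => q.1 : V).
Proof. by apply: (@Ck_lin R (V * W)%type V k _ fst openT) => x; exact: cvg_fst. Qed.

Lemma Ck_snd (V W : normedModType R) k : Ck k [set: (V * W)%type] (fun q => q.2 : W).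
Proof. by apply: (@Ck_lin R (V * W)%type W k _ snd openT) => x; exact: cvg_snd. Qed.

End Frames.

Lemma open_setI_preimage (T S : topologicalType) (U : set T) (U' : set S)
    (f : T -> S) :
  open U -> open U' -> (forall x, U x -> {for x, continuous f}) ->
  open (U `&` f @^-1` U').
Proof.
move=> oU oU' fc; rewrite openE => x [Ux U'fx].
apply: filterI; first exact: open_nbhs_nbhs.
by apply: (fc x Ux); apply: open_nbhs_nbhs.
Qed.

Section SmoothFamilies.
Variables (R : realType) (m : nat) (M : closedManifold R m).
Implicit Types (P Q : normedModType R) (x : M).

Lemma chart_at_atlas x : atlas (chart_at x).
Proof. by rewrite /chart_at; case: cid => c /= []. Qed.

Lemma chart_at_dom x : chart_dom (chart_at x) x.
Proof. by rewrite /chart_at; case: cid => c /= []. Qed.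

Lemma smooth_family_reparam P Q (A : set Q) (B : set P) (a : Q -> P)
    (F : P -> M -> M) :
  has_frame P -> has_frame Q -> Cinf setT a -> (forall s, A s -> B (a s)) ->
  smooth_family B F -> smooth_family A (fun s => F (a s)).
Proof.
move=> hP hQ ha aAB hF s x c d As ac ad cx dx.
have [U [oU Us UF UC]] := hF (a s) x c d (aAB s As) ac ad cx dx.
pose th (q : (Q * 'rV[R]_m)%type) := (a q.1, q.2).
have thk k : Ck k setT th.
  apply: Ck_pair; [exact: openT| |exact: Ck_snd].
  apply: (Ck_comp (U' := setT) hQ) => //; [exact: openT|exact: Ck_fst].
exists (th @^-1` U); split => //.
- have := open_setI_preimage openT oU (thk 0%N); by rewrite setTI.
- by move=> q /UF.
- move=> k; apply: (Ck_comp (U' := U) (f := th)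
    (g := fun q => chart_map d (F q.1 (chart_inv c q.2)))).
  + exact: has_frame_prod hP (has_frame_row R m).
  + by have := open_setI_preimage openT oU (thk 0%N); rewrite setTI.
  + by [].
  + exact: Ck_sub (@subsetT _ _) (thk k).
  + exact: UC.
Qed.

(** The middle point is read in its preferred chart [e]; as [e] inverts itself
    on its domain, the representative of the composite is the composite of the
    representatives, and no change of charts enters. *)
Lemma smooth_family_comp P (A : set P) (F G : P -> M -> M) :
  has_frame P -> smooth_family A F -> smooth_family A G ->
  smooth_family A (fun s => F s \o G s).
Proof.
move=> hP hF hG s x c d As ac ad cx dx /=.
pose e := chart_at (G s x).
have [U1 [oU1 U1s U1G C1]] :=
  hG s x c e As ac (chart_at_atlas _) cx (chart_at_dom _).
have [U2 [oU2 U2s U2F C2]] :=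
  hF s (G s x) e d As (chart_at_atlas _) ad (chart_at_dom _) dx.
pose th (q : (P * 'rV[R]_m)%type) := (q.1, chart_map e (G q.1 (chart_inv c q.2))).
have thk k : Ck k U1 th.
  by apply: Ck_pair => //; apply: Ck_sub (@Ck_fst _ _ _ k).
have oU := open_setI_preimage oU1 oU2 (thk 0%N).
have thE q : U1 q -> chart_inv e (th q).2 = G q.1 (chart_inv c q.2).
  by move=> /U1G[_ Gd]; rewrite /th /= (chart_mapK Gd).
exists (U1 `&` th @^-1` U2); split => //.
+ by split=> //=; rewrite /th /= (chart_mapK cx).
+ by move=> q [U1q /U2F[_ +]]; rewrite (thE q U1q); case: (U1G q U1q).
+ move=> k; apply: (Ck_eq oU (f := fun q => chart_map d (F (th q).1 (chart_inv e (th q).2)))).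
    by move=> q [U1q _]; rewrite (thE q U1q).
  apply: (Ck_comp (U' := U2) (f := th)
    (g := fun q => chart_map d (F q.1 (chart_inv e q.2)))) => //.
  - exact: has_frame_prod hP (has_frame_row R m).
  - by move=> q [].
  - by apply: Ck_sub (thk k) => q [].
Qed.

End SmoothFamilies.

(** * Velocities and local representatives *)

Definition local_rep (R : realType) (m : nat) (M : closedManifold R m)
    (P : Type) (F : P -> M -> M) (c d : chart R m M) (q : P * 'rV[R]_m) :
    'rV[R]_m :=
  chart_map d (F q.1 (chart_inv c q.2)).

Definition smooth_rep_on (R : realType) (m : nat) (M : closedManifold R m)
    (P : normedModType R) (F : P -> M -> M) (c d : chart R m M)
    (U : set (P * 'rV[R]_m)%type) : Prop :=
  [/\ open U,
      forall q, U q -> chart_im c q.2 /\ chart_dom d (F q.1 (chart_inv c q.2))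
    & Cinf U (local_rep F c d)].

(** The value of [velocity] is meaningful only where the curve is differentiable
    and stays in the domain of the chart used; these conditions are part of the
    present notion, which therefore composes. *)
Definition has_velocity (R : realType) (m : nat) (M : closedManifold R m)
    (g : R -> M) (s : R) (v : 'rV[R]_m) : Prop :=
  (\forall u \near s, chart_dom (chart_at (g s)) (g u)) /\
  is_diff (s : R^o) (fun u : R^o => chart_map (chart_at (g s)) (g u))
    (fun h : R^o => h *: v).

Section PartialDerivatives.
Variables (R : realType).
Implicit Types (V W X : normedModType R).

Lemma diffE_is V W (f df : V -> W) x v : is_diff x f df -> 'd f x v = df v.
Proof. by move=> [_ ->]. Qed.

Lemma curve_is_diff V W (f : V -> W) (g : R^o -> V) (s : R^o) (v : V) :
  differentiable f (g s) -> is_diff s g (fun h => h *: v) ->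
  is_diff s (f \o g) (fun h => h *: 'd f (g s) v).
Proof.
move=> /differentiableP df dg; apply: is_diff_eq (is_diff_comp dg df) _.
by rewrite funeqE => h /=; rewrite linearZ.
Qed.

Lemma partial1_is_diff W X (f : (R^o * W)%type -> X) (s : R^o) (y : W) :
  differentiable f (s, y) ->
  is_diff s (fun u => f (u, y)) (fun h => h *: 'd f (s, y) (1, 0)).
Proof.
move=> df; apply: (curve_is_diff (g := fun u : R^o => (u, y)) df).
apply: is_diff_eq (is_diff_pair (is_diff_id s) (is_diff_cst y s)) _.
rewrite funeqE => h; congr (_, _) => /=; last by rewrite scaler0.
by rewrite /GRing.scale /= mulr1.
Qed.

Lemma partial2_is_diff V W X (f : (V * W)%type -> X) (s : V) (y : W) :
  differentiable f (s, y) ->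
  is_diff y (fun z => f (s, z)) (fun w => 'd f (s, y) (0, w)).
Proof.
move=> /differentiableP df.
exact: is_diff_comp (is_diff_pair (is_diff_cst s y) (is_diff_id y)) df.
Qed.

End PartialDerivatives.

Section LocalRepresentatives.
Variables (R : realType) (m : nat) (M : closedManifold R m).
Implicit Types (P : normedModType R) (x : M) (c d : chart R m M).

Lemma smooth_rep_diff P (F : P -> M -> M) c d U q :
  smooth_rep_on F c d U -> U q -> differentiable (local_rep F c d) q.
Proof. by move=> [_ _ C]; case: (C 1%N) => + _; apply. Qed.

Lemma smooth_familyP P (A : set P) (F : P -> M -> M) s x c d :
  smooth_family A F -> A s -> atlas c -> atlas d ->
  chart_dom c x -> chart_dom d (F s x) ->
  exists U, smooth_rep_on F c d U /\ U (s, chart_map c x).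
Proof.
by move=> h As ac ad cx dx; have [U [? ? ? ?]] := h s x c d As ac ad cx dx; exists U.
Qed.

Lemma near_fst P (U : set (P * 'rV[R]_m)%type) s p :
  open U -> U (s, p) -> \forall u \near s, U (u, p).
Proof.
move=> oU Us.
have cp : {for s, continuous (fun u : P => (u, p))}.
  have cst_p : {for s, continuous (fun=> p : 'rV[R]_m)} by exact: cvg_cst.
  exact: (cvg_pair (@cvg_id _ (nbhs s)) cst_p).
exact: (cp U (open_nbhs_nbhs (conj oU Us))).
Qed.

Lemma chart_change_diff c d x : atlas c -> atlas d ->
  chart_dom c x -> chart_dom d x ->
  differentiable (chart_map d \o chart_inv c) (chart_map c x).
Proof.
move=> ac ad cx dx; have [h _] := atlas_compat ac ad 1%N.
by apply: h; exists x.
Qed.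

Lemma velocity_rep (F : R -> M -> M) c U (s : R) x :
  smooth_rep_on (F : R^o -> M -> M) c (chart_at (F s x)) U ->
  chart_dom c x -> U (s : R^o, chart_map c x) ->
  has_velocity (F^~ x) s (velocity F s x) /\
  velocity F s x =
  'd (local_rep (F : R^o -> _) c (chart_at (F s x))) (s : R^o, chart_map c x) (1, 0).
Proof.
move=> UF cx Us; have [oU Ud _] := UF; set d := chart_at (F s x) in UF Ud *.
have D := partial1_is_diff (smooth_rep_diff UF Us).
have D' : is_diff (s : R^o) (fun u : R^o => chart_map d (F u x))
    (fun h : R^o => h *: 'd (local_rep (F : R^o -> _) c d) (s : R^o, chart_map c x) (1, 0)).
  apply: near_is_diff D; apply: filterE => u.
  by rewrite /local_rep /= chart_mapK.
have vE : velocity F s x = 'd (local_rep (F : R^o -> _) c d) (s : R^o, chart_map c x) (1, 0).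
  rewrite /velocity derive1E deriveE; last by case: D'.
  by rewrite (diffE_is _ D') scale1r.
split; last exact: vE.
split; last by rewrite vE.
apply: filterS (near_fst oU Us) => u /Ud[_ /=].
by rewrite chart_mapK.
Qed.

Lemma smooth_has_velocity (A : set R^o) (F : R -> M -> M) (s : R) x :
  smooth_family (P := R^o) A F -> A s ->
  has_velocity (F^~ x) s (velocity F s x).
Proof.
move=> hF As.
have [U [UF Us]] := smooth_familyP hF As (chart_at_atlas x)
  (chart_at_atlas (F s x)) (chart_at_dom x) (chart_at_dom (F s x)).
by have [] := velocity_rep UF (chart_at_dom x) Us.
Qed.

Lemma has_velocityE (F : R -> M -> M) (s : R) x v :
  has_velocity (F^~ x) s v -> velocity F s x = v.
Proof.
move=> [_ D]; rewrite /velocity derive1E deriveE; last by case: D.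
by rewrite (diffE_is _ D) scale1r.
Qed.

Lemma has_velocity_reparam (g : R -> M) (b : R^o -> R^o) (s db : R) v :
  is_diff (s : R^o) b (fun h : R^o => h *: (db : R^o)) ->
  has_velocity g (b s) v ->
  has_velocity (g \o b) s (db *: v).
Proof.
move=> Db [ng D]; split.
  have /differentiable_continuous bc : differentiable b (s : R^o) by case: Db.
  exact: (bc _ ng).
apply: is_diff_eq (is_diff_comp Db D) _.
by rewrite funeqE => h /=; rewrite scalerA.
Qed.

Lemma has_velocity_family (A : set R^o) (F : R -> M -> M) (a : R^o -> R^o)
    (g : R -> M) (s da : R) v :
  smooth_family (P := R^o) A F -> A (a s) ->
  is_diff (s : R^o) a (fun h : R^o => h *: (da : R^o)) ->
  has_velocity g s v ->
  has_velocity (fun u => F (a u) (g u)) s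
    (da *: velocity F (a s) (g s) + tangent_map (F (a s)) (g s) v).
Proof.
move=> hF As Da [ng Dg].
pose c := chart_at (g s); pose y := F (a s) (g s); pose d := chart_at y.
have [U [UF Us]] := smooth_familyP hF As (chart_at_atlas (g s))
  (chart_at_atlas y) (chart_at_dom (g s)) (chart_at_dom y).
have [oU Ud _] := UF.
pose th (u : R^o) : (R^o * 'rV[R]_m)%type := (a u, chart_map c (g u)).
have Dth : is_diff (s : R^o) th (fun h : R^o => h *: (da : R^o, v)).
  exact: is_diff_eq (is_diff_pair Da Dg) _.
have /differentiable_continuous thc : differentiable th (s : R^o) by case: Dth.
have nU : \forall u \near (s : R^o), U (th u).
  exact: (thc U (open_nbhs_nbhs (conj oU Us))).
have thE u : chart_dom c (g u) -> local_rep F c d (th u) = chart_map d (F (a u) (g u)).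
  by move=> cg; rewrite /local_rep /= chart_mapK.
split.
  near=> u.
  have cg : chart_dom c (g u) by near: u; exact: ng.
  have /Ud[_ /=] : U (th u) by near: u.
  by rewrite chart_mapK.
have dL := smooth_rep_diff UF Us.
have D := curve_is_diff dL Dth.
have {D} : is_diff (s : R^o) (fun u : R^o => chart_map d (F (a u) (g u)))
    (fun h : R^o => h *: 'd (local_rep (F : R^o -> _) c d) (th s) (da : R^o, v)).
  apply: near_is_diff D; near=> u; apply: thE.
  by near: u; exact: ng.
congr (is_diff_def _ _ _); rewrite funeqE => h; congr (_ *: _).
have -> : (da : R^o, v) = da *: (1 : R^o, 0 : 'rV[R]_m) + (0, v).
  by congr (_, _) => /=; rewrite ?scaler0 ?add0r// addr0 /GRing.scale /= mulr1.
rewrite linearD linearZ; congr (_ *: _ + _).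
  have := partial1_is_diff dL => D1; rewrite /velocity.
  rewrite derive1E.
  have D2 : is_diff (a s : R^o) (fun u : R^o => chart_map d (F u (g s)))
    (fun h : R^o => h *: 'd (local_rep (F : R^o -> _) c d) (th s) (1, 0)).
    apply: near_is_diff D1; apply: filterE => u.
    by rewrite /local_rep /= chart_mapK//; exact: chart_at_dom.
  rewrite deriveE; last by case: D2.
  by rewrite (diffE_is _ D2) scale1r.
by rewrite /tangent_map (diffE_is _ (partial2_is_diff dL)).
Unshelve. all: by end_near. Qed.

End LocalRepresentatives.

(** * Symmetry of second derivatives *)

Section SecondDerivatives.
Variable R : realType.
Implicit Types V W X : normedModType R.

Lemma is_diff_derive V (f : V -> R^o) (p v : V) (s : R) :
  differentiable f (p + s *: v) ->
  is_derive s (1 : R) (fun a : R => f (p + a *: v) : R) ('d f (p + s *: v) v).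
Proof.
move=> df.
have dg : is_diff (s : R^o) (fun a : R^o => p + a *: v) (fun h => h *: v).
  apply: is_diff_eq (is_diffD (is_diff_cst p (s : R^o)) (is_diff_scalel (s : R^o) v)) _.
  by rewrite add0r.
have D := curve_is_diff df dg.
have D1 : differentiable (f \o (fun a : R^o => p + a *: v)) (s : R^o) by case: D.
apply: DeriveDef; first exact: diff_derivable D1.
by rewrite (deriveE _ D1) (diffE_is _ D) scale1r.
Qed.

Lemma line_MVT V (f : V -> R^o) (p v : V) (h : R) : 0 < h ->
  (forall a, 0 <= a <= h -> differentiable f (p + a *: v)) ->
  exists2 a, 0 <= a <= h & f (p + h *: v) - f p = h * 'd f (p + a *: v) v.
Proof.
move=> h0 df.
have der a : a \in `]0, h[ -> is_derive a (1 : R)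
    (fun a : R => f (p + a *: v) : R) ('d f (p + a *: v) v).
  by move=> /itvP ah; apply: is_diff_derive; apply: df; rewrite !ah.
have cont : {within `[0, h], continuous (fun a : R => f (p + a *: v) : R)}.
  apply: derivable_within_continuous => a /itvP ah.
  have [] // := @is_diff_derive _ f p v a _.
  by apply: df; rewrite !ah.
have [a ah E] := MVT h0 der cont.
exists a; first by rewrite !(itvP ah).
by move: E; rewrite scale0r addr0 subr0 mulrC.
Qed.

Let second_difference V (f : V -> R^o) (x v w : V) (h : R) : R :=
  f (x + h *: v + h *: w) - f (x + h *: v) - (f (x + h *: w) - f x).

(** Two applications of the mean value theorem, along [v] and then along [w],
    turn the second difference into the mixed derivative at a nearby point. *)
Lemma second_difference_approx V (U : set V) (f : V -> R^o) (x v w : V) (e : R) :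
  open U -> Ck 2 U f -> U x -> 0 < e ->
  \forall h \near 0^'+,
    `|second_difference f x v w h - h ^+ 2 * 'd (fun y => 'd f y v) x w|
      <= e * h ^+ 2.
Proof.
move=> oU [f1 f2] Ux e0; have [f3 f4] := f2 v.
pose S y := 'd (fun y => 'd f y v : R^o) y w.
have Sc : {for x, continuous S} by exact: (f4 w).
have : \forall y \near x, U y /\ `|S x - S y| <= e.
  apply: filterI; first exact: open_nbhs_nbhs (conj oU Ux).
  by move/cvgr_dist_le : Sc; apply.
move=> /nbhs_ballP[r /= r0 br].
pose K := `|v| + `|w| + 1.
have K0 : 0 < K by rewrite ltr_pwDr// addr_ge0.
have inball a b h : 0 <= a <= h -> 0 <= b <= h -> h < r / K ->
    ball x r (x + a *: v + b *: w).
  move=> /andP[a0 ah] /andP[b0 bh] hK.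
  rewrite -ball_normE /= -addrA opprD addrA subrr sub0r normrN.
  apply: le_lt_trans (ler_normD _ _) _; rewrite !normrZ !ger0_norm//.
  apply: (@le_lt_trans _ _ (h * K)); last by rewrite -ltr_pdivlMr.
  rewrite /K !mulrDr -[leLHS]addr0; apply: lerD; last by rewrite mulr1 (le_trans a0).
  by apply: lerD; apply: ler_wpM2r.
near=> h.
have h0 : 0 < h by near: h; exact: nbhs_right_gt.
have hK : h < r / K by near: h; apply: nbhs_right_lt; rewrite divr_gt0.
have h0h : 0 <= h <= h by rewrite lexx ltW.
have z0h : (0 : R) <= 0 <= h by rewrite lexx ltW.
have Ub a b : 0 <= a <= h -> 0 <= b <= h -> U (x + a *: v + b *: w).
  by move=> ah bh; have [] := br _ (inball a b h ah bh hK).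
have dshift y : U (y + h *: w) -> is_diff y (fun y => f (y + h *: w)) ('d f (y + h *: w)).
  move=> Uy; have Df := differentiableP (f1 _ Uy).
  have Ds : is_diff y (fun y => y + h *: w) id.
    apply: is_diff_eq (is_diffD (is_diff_id y) (is_diff_cst (h *: w) y)) _.
    by rewrite addr0.
  exact: (is_diff_comp Ds Df).
have dF a : 0 <= a <= h -> is_diff (x + a *: v)
    (fun y => f (y + h *: w) - f y)
    (fun u => 'd f (x + a *: v + h *: w) u - 'd f (x + a *: v) u).
  move=> ah; have Ua : U (x + a *: v).
    by have := Ub a 0 ah z0h; rewrite scale0r addr0.
  have Df := differentiableP (f1 _ Ua).
  exact: (is_diffB (dshift _ (Ub a h ah h0h)) Df).
have [a ah Ea] : exists2 a, 0 <= a <= h & second_difference f x v w h =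
    h * ('d f (x + a *: v + h *: w) v - 'd f (x + a *: v) v).
  have [a ah|a ah E] := @line_MVT _ (fun y => f (y + h *: w) - f y) x v h h0.
    by case: (dF a ah).
  exists a; first exact: ah.
  by rewrite /second_difference E (diffE_is v (dF a ah)).
have [b bh Eb] := @line_MVT _ (fun y => 'd f y v) (x + a *: v) w h h0
   (fun b bh => f3 _ (Ub a b ah bh)).
rewrite Ea Eb mulrA -expr2 -mulrBr normrM ger0_norm ?exprn_ge0 ?(ltW h0)// mulrC.
apply: ler_wpM2r; first by rewrite exprn_ge0// ltW.
by rewrite distrC; have [] := br _ (inball a b h ah bh hK).
Unshelve. all: by end_near. Qed.

(** The second difference is symmetric in [v] and [w], so the two mixed
    derivatives are limits of the same quotient. *)
Lemma schwarz_real V (U : set V) (f : V -> R^o) (x v w : V) :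
  open U -> Ck 2 U f -> U x ->
  'd (fun y => 'd f y v) x w = 'd (fun y => 'd f y w) x v.
Proof.
move=> oU f2 Ux; apply/eqP; rewrite -subr_eq0 -normr_le0.
apply/ler_addgt0Pl => e e0; rewrite addr0.
have e20 : 0 < e / 2 by rewrite divr_gt0.
have := second_difference_approx v w oU f2 Ux e20.
have := second_difference_approx w v oU f2 Ux e20.
move=> H1 H2; near (0 : R)^'+ => h.
have h0 : 0 < h by near: h; exact: nbhs_right_gt.
have A1 : `|second_difference f x w v h - h ^+ 2 * 'd (fun y => 'd f y w) x v|
      <= e / 2 * h ^+ 2 by near: h.
have A2 : `|second_difference f x v w h - h ^+ 2 * 'd (fun y => 'd f y v) x w|
      <= e / 2 * h ^+ 2 by near: h.
have E : second_difference f x w v h = second_difference f x v w h.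
  by rewrite /second_difference (addrAC x); ring.
rewrite E in A1.
have hh : 0 < h ^+ 2 by rewrite exprn_gt0.
rewrite -(ler_pM2r hh) -[X in _ * X](gtr0_norm hh) -normrM.
move: A1 A2; set p := h ^+ 2 * _; set q := h ^+ 2 * _; set d := second_difference _ _ _ _ _.
have -> : ('d (fun y => 'd f y v) x w - 'd (fun y => 'd f y w) x v) * h ^+ 2
    = (d - p) - (d - q) by rewrite /p /q; ring.
move=> A1 A2; apply: le_trans (ler_normB _ _) _.
by rewrite (splitr e) mulrDl lerD.
Unshelve. all: by end_near. Qed.

Lemma schwarz V X (U : set V) (f : V -> X) (x v w : V) :
  has_frame X -> open U -> Ck 2 U f -> U x ->
  'd (fun y => 'd f y v) x w = 'd (fun y => 'd f y w) x v.
Proof.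
move=> [n [e [c [cc ce]]]] oU f2 Ux.
have D (l : {linear X -> R^o}) (g : V -> X) y u : continuous l ->
    differentiable g y -> 'd (l \o g) y u = l ('d g y u).
  move=> lc dg; rewrite diff_comp//; last exact: linear_differentiable.
  by rewrite /= diff_lin.
have D2 (l : {linear X -> R^o}) u u' : continuous l ->
    'd (fun y => 'd (l \o f) y u) x u' = l ('d (fun y => 'd f y u) x u').
  move=> lc; have [f1 f1'] := f2; have [f3 _] := f1' u.
  have <- := D l _ x u' lc (f3 x Ux).
  apply: diffE_is; apply: (@near_is_diff _ _ _ (l \o (fun y => 'd f y u))).
    by apply: filterS (open_nbhs_nbhs (conj oU Ux)) => y Uy; rewrite D//; exact: f1.
  by apply: differentiableP; apply: differentiable_comp;
    [exact: f3|exact: linear_differentiable].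
rewrite [LHS]ce [RHS]ce; apply: eq_bigr => i _; congr (_ *: _).
rewrite -!D2//; apply: (schwarz_real v w oU) => //.
exact: Ck_linr.
Qed.

End SecondDerivatives.

(** * One-forms along curves and families *)

Section Pairings.
Variable R : realType.
Implicit Types V W X : normedModType R.

Lemma sum_is_diff V W n (f df : 'I_n -> V -> W) x :
  (forall i, is_diff x (f i) (df i)) ->
  is_diff x (fun y => \sum_i f i y) (fun v => \sum_i df i v).
Proof.
elim: n f df => [|n IH] f df hf.
  under eq_fun do rewrite big_ord0; under [X in is_diff_def _ _ X]eq_fun do rewrite big_ord0.
  exact: (is_diff_cst 0 x).
under eq_fun do rewrite big_ord_recr /=.
under [X in is_diff_def _ _ X]eq_fun do rewrite big_ord_recr /=.
exact: (is_diffD (IH _ _ (fun i => hf _)) (hf ord_max)).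
Qed.

(** The Leibniz rule for a linear form that varies with the base point. *)
Lemma pairing_is_diff V W X (A : W -> {linear X -> R^o}) (f : V -> W) (w : V -> X)
    (df : V -> W) (dw : V -> X) x :
  has_frame X -> (forall u, differentiable (fun z => A z u) (f x)) ->
  is_diff x f df -> is_diff x w dw ->
  is_diff x (fun y => A (f y) (w y))
    (fun v => A (f x) (dw v) + 'd (fun z => A z (w x)) (f x) (df v)).
Proof.
move=> [n [e [c [cc ce]]]] dA hf hw.
have hc i : is_diff x (fun y => c i (w y)) (fun v => c i (dw v)).
  have L : is_diff (w x) (c i) (c i).
    by apply: DiffDef; [exact: linear_differentiable|exact: diff_lin].
  exact: (is_diff_comp hw L).
have hA i : is_diff x (fun y => A (f y) (e i))
    (fun v => 'd (fun z => A z (e i)) (f x) (df v)).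
  exact: (is_diff_comp hf (differentiableP (dA (e i)))).
have -> : (fun y => A (f y) (w y)) = (fun y => \sum_i c i (w y) *: (A (f y) (e i) : R^o)).
  rewrite funeqE => y; rewrite [in LHS](ce (w y)) linear_sum.
  by apply: eq_bigr => i _; rewrite linearZ.
apply: is_diff_eq (sum_is_diff (fun i => scale_is_diff (hc i) (hA i))) _.
rewrite funeqE => v; rewrite big_split /= addrC; congr (_ + _).
  rewrite [in RHS](ce (dw v)) linear_sum.
  by apply: eq_bigr => i _; rewrite linearZ.
have -> : (fun z => A z (w x)) = (fun z => \sum_i c i (w x) *: (A z (e i) : R^o)).
  rewrite funeqE => y; rewrite [in LHS](ce (w x)) linear_sum.
  by apply: eq_bigr => i _; rewrite linearZ.
symmetry.
have := sum_is_diff (fun i => scale_is_diff (is_diff_cst (c i (w x)) (f x))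
   (differentiableP (dA (e i)))).
move=> /diffE_is ->; apply: eq_bigr => i _.
by rewrite scale0r addr0.
Qed.

Lemma pairing_continuous (T : topologicalType) W X (A : W -> X -> R^o)
    (f : T -> W) (w : T -> X) t :
  has_frame X -> (forall z, linear (A z)) ->
  (forall u, {for f t, continuous (fun z => A z u)}) ->
  {for t, continuous f} -> {for t, continuous w} ->
  {for t, continuous (fun y => A (f y) (w y))}.
Proof.
move=> [n [e [c [cc ce]]]] lA cA hf hw.
have -> : (fun y => A (f y) (w y)) = (fun y => \sum_i c i (w y) *: (A (f y) (e i) : R^o)).
  rewrite funeqE => y; rewrite [in LHS](ce (w y)).
  pose l : {linear X -> R^o} :=
    HB.pack (A (f y)) (GRing.isLinear.Build _ _ _ _ _ (lA (f y))).
  rewrite -[LHS]/(l _) linear_sum.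
  by apply: eq_bigr => i _; rewrite linearZ.
apply: cvg_big => [|i _]; first exact: add_continuous.
apply: cvgZ.
  by apply: (@continuous_comp _ _ _ w (c i)) => //; exact: cc.
exact: (@continuous_comp _ _ _ f (fun z => A z (e i))).
Qed.

End Pairings.

Section Forms.
Variables (R : realType) (m : nat) (M : closedManifold R m) (alpha : oneForm M).
Implicit Types (P : normedModType R) (x : M) (c d : chart R m M).

(** [form_in_chart] as a linear form in the tangent vector. *)
Definition form_lin c (p : 'rV[R]_m) : {linear 'rV[R]_m -> R^o} :=
  let x := chart_inv c p in
  alpha x \o 'd (fun q => chart_map (chart_at x) (chart_inv c q)) p.

Lemma form_linE c y v : chart_dom c y -> form_lin c (chart_map c y) v =
  alpha y ('d (chart_map (chart_at y) \o chart_inv c) (chart_map c y) v).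
Proof. by move=> cy; rewrite /form_lin /= chart_mapK. Qed.

(** The charts of [velocity] and [tangent_map] jump with the point. In a fixed
    chart [d] the pairing with [alpha] becomes an expression that can be
    differentiated; [form_tangent] does the same for transported vectors. *)
Lemma form_velocity (F : R -> M -> M) c d U (s : R) x :
  smooth_rep_on (F : R^o -> M -> M) c d U -> atlas d ->
  chart_dom c x -> U (s : R^o, chart_map c x) ->
  alpha (F s x) (velocity F s x) =
  form_lin d (local_rep (F : R^o -> _) c d (s, chart_map c x))
    ('d (local_rep (F : R^o -> _) c d) (s : R^o, chart_map c x) (1, 0)).
Proof.
move=> UF ad cx Us; have [oU Ud _] := UF.
have [_ /=] := Ud _ Us; rewrite chart_mapK// => dF.
have Dc := chart_change_diff ad (chart_at_atlas (F s x)) dF (chart_at_dom _).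
have D0 : local_rep (F : R^o -> _) c d (s : R^o, chart_map c x) = chart_map d (F s x).
  by rewrite /local_rep /= chart_mapK.
rewrite D0; apply: etrans (esym (form_linE _ dF)); congr (alpha _ _).
have Dc' := Dc; rewrite -D0 in Dc'.
have D := is_diff_comp (partial1_is_diff (smooth_rep_diff UF Us)) (differentiableP Dc').
have nU := near_fst oU Us.
have nE : \forall u \near (s : R^o),
    ((chart_map (chart_at (F s x)) \o chart_inv d) \o
      (fun u : R^o => local_rep (F : R^o -> _) c d (u, chart_map c x))) u =
    chart_map (chart_at (F s x)) (F u x).
  apply: filterS nU => u /Ud[_ /=] dFu.
  by rewrite /local_rep /=; rewrite chart_mapK// in dFu *; rewrite chart_mapK.
have D' := near_is_diff nE D.
rewrite /velocity derive1E deriveE; last by case: D'.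
by rewrite (diffE_is _ D') /= scale1r D0.
Qed.

Lemma form_tangent P (F : P -> M -> M) d U (s : P) x v :
  smooth_rep_on F (chart_at x) d U -> atlas d ->
  U (s, chart_map (chart_at x) x) ->
  alpha (F s x) (tangent_map (F s) x v) =
  form_lin d (local_rep F (chart_at x) d (s, chart_map (chart_at x) x))
    ('d (local_rep F (chart_at x) d) (s, chart_map (chart_at x) x) (0, v)).
Proof.
move=> UF ad Us; have [oU Ud _] := UF; set c := chart_at x in UF Us Ud *.
have cx : chart_dom c x := chart_at_dom x.
have [_ /=] := Ud _ Us; rewrite chart_mapK// => dF.
have Dc := chart_change_diff ad (chart_at_atlas (F s x)) dF (chart_at_dom _).
have D0 : local_rep F c d (s, chart_map c x) = chart_map d (F s x).
  by rewrite /local_rep /= chart_mapK.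
rewrite D0; apply: etrans (esym (form_linE _ dF)); congr (alpha _ _).
have Dc' := Dc; rewrite -D0 in Dc'.
have D := is_diff_comp (partial2_is_diff (smooth_rep_diff UF Us)) (differentiableP Dc').
have nU : \forall p \near chart_map c x, U (s, p).
  have [[A B] /= [nA nB] AB] := open_nbhs_nbhs (conj oU Us).
  apply: filterS nB => p Bp; apply: AB; split=> //=; exact: nbhs_singleton nA.
have nE : \forall p \near chart_map c x,
    ((chart_map (chart_at (F s x)) \o chart_inv d) \o
      (fun p => local_rep F c d (s, p))) p =
    chart_map (chart_at (F s x)) (F s (chart_inv c p)).
  apply: filterS nU => p /Ud[_ /=] dFu.
  by rewrite /local_rep /= chart_mapK.
have D' := near_is_diff nE D.
rewrite -D0; exact: (diffE_is v D').
Qed.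

Lemma form_lin_diff c p v : smooth_form alpha -> atlas c -> chart_im c p ->
  differentiable (fun q => form_lin c q v) p.
Proof. by move=> sa ac cp; have [+ _] := sa c ac v 1%N; apply. Qed.

End Forms.

(** Near each point the pairing is read off in fixed charts, by [form_velocity],
    although [velocity] itself jumps with the charts. *)
Lemma form_velocity_continuous (R : realType) (m : nat) (M : closedManifold R m)
    (alpha : oneForm M) (A : set R^o) (f : R -> M -> M) (s : R) (x : M) :
  smooth_form alpha -> smooth_family (P := R^o) A f -> A s ->
  {for (s, x), continuous (fun q : R * M => alpha (f q.1 q.2) (velocity f q.1 q.2) : R)}.
Proof.
move=> sa sf As.
pose c := chart_at x; pose d := chart_at (f s x).
have [U [UF Us]] := smooth_familyP sf As (chart_at_atlas x)
  (chart_at_atlas (f s x)) (chart_at_dom x) (chart_at_dom (f s x)).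
have [oU Ud CU] := UF.
pose Phi := local_rep (f : R^o -> _) c d.
pose th (q : R * M) : (R^o * 'rV[R]_m)%type := (q.1 : R^o, chart_map c q.2).
have cx := chart_at_dom x.
have thc : {for (s, x), continuous th}.
  move=> W [[B C] /= [nB nC] BC].
  exists (B, chart_map c @^-1` C).
    by split=> //; exact: (chart_map_cont cx nC).
  by move=> [u y] [/= Bu Cy]; apply: BC.
have Phi0 : Phi (th (s, x)) = chart_map d (f s x).
  by rewrite /Phi /local_rep /= chart_mapK.
have nG : \forall q \near (s, x), form_lin alpha d (Phi (th q)) ('d Phi (th q) (1, 0)) =
    alpha (f q.1 q.2) (velocity f q.1 q.2).
  have nU : \forall q \near (s, x), U (th q) := thc U (open_nbhs_nbhs (conj oU Us)).
  have nc : \forall q \near (s, x), chart_dom c q.2.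
    exists (setT, chart_dom c); last by move=> q [].
    split=> /=; first exact: filterT.
    exact: (open_nbhs_nbhs (conj (chart_dom_open c) cx)).
  apply: filterS2 nU nc => -[u y] Uq cy.
  exact: (esym (form_velocity alpha UF (chart_at_atlas (f s x)) cy Uq)).
have dPhi : differentiable Phi (th (s, x)) := smooth_rep_diff UF Us.
have [_ C1] := CU 2%N; have [dW _] := C1 (1, 0).
have H : {for (s, x), continuous (fun q : R * M =>
    form_lin alpha d (Phi (th q)) ('d Phi (th q) (1, 0)))}.
  apply: (@pairing_continuous R (R * M)%type _ _ (fun z v => form_lin alpha d z v)
    (Phi \o th) (fun q => 'd Phi (th q) (1, 0)) (s, x) (has_frame_row R m)).
  - by move=> z k u v; rewrite linearP.
  - move=> v; apply/differentiable_continuous/form_lin_diff => //; first exact: chart_at_atlas.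
    by rewrite /= Phi0; exists (f s x) => //; exact: chart_at_dom.
  - apply: (@continuous_comp _ _ _ th Phi) => //.
    exact: differentiable_continuous.
  - apply: (@continuous_comp _ _ _ th (fun q => 'd Phi q (1, 0))) => //.
    exact/differentiable_continuous/dW.
rewrite /prop_for /continuous_at -(nbhs_singleton nG).
by apply: cvg_trans H; exact: near_eq_cvg.
Qed.

(** * The Reeb flow preserves the contact form *)

Section ReebFlow.
Variables (R : realType) (n : nat) (M : closedContactManifold R n).
Variables (alpha : oneForm M) (X : M -> 'rV[R]_(n.*2.+1)) (phi : R -> M -> M).
Hypotheses (salpha : smooth_form alpha) (reebX : reeb_field alpha X)
  (flowX : flow_of X phi).

(** Cartan's formula for the Reeb field [X], where both terms vanish:
    [alpha X] is constant, and [X] is in the kernel of the differential of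
    [alpha]. In coordinates, the derivative of [alpha (phi_u x) (d phi_u v)] in
    [u] and the vanishing derivative of [alpha X = 1] along [v] differ by
    [dform alpha] and by two mixed derivatives of the flow, which agree.
    The chart is the preferred one at the point [phi u0 x], as [dform] is
    defined in that chart. *)
Lemma reeb_pullback_derive (x : M) v (u0 : R) :
  is_derive u0 (1 : R) (fun u => alpha (phi u x) (tangent_map (phi u) x v) : R) 0.
Proof.
have [sphi phi0 phiD velX] := flowX.
pose c := chart_at x; pose y := phi u0 x; pose d := chart_at y.
pose p := chart_map c x.
have [U [UF Us]] := smooth_familyP sphi (I : [set: R^o] u0) (chart_at_atlas x)
  (chart_at_atlas y) (chart_at_dom x) (chart_at_dom y).
have [oU Ud CU] := UF.
pose Phi := local_rep (phi : R^o -> _) c d.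
pose q0 : (R^o * 'rV[R]_(n.*2.+1))%type := (u0, p).
pose W1 q := 'd Phi q (1, 0); pose W2 q := 'd Phi q (0, v).
have [dPhi C1] := CU 2%N.
have dW1 : differentiable W1 q0 by case: (C1 (1, 0)) => + _; apply.
have dW2 : differentiable W2 q0 by case: (C1 (0, v)) => + _; apply.
have Phi0 : Phi q0 = chart_map d y.
  by rewrite /Phi /local_rep /= chart_mapK//; exact: chart_at_dom.
have dA w : differentiable (fun z => form_lin alpha d z w) (Phi q0).
  apply: form_lin_diff => //; first exact: chart_at_atlas.
  by rewrite Phi0; exists y => //; exact: chart_at_dom.
have frm := has_frame_row R n.*2.+1.
have D1 := pairing_is_diff frm dA (differentiableP (dPhi q0 Us)) (differentiableP dW1).
have D2 := pairing_is_diff frm dA (differentiableP (dPhi q0 Us)) (differentiableP dW2).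
have nU : \forall q \near q0, U q by exact: open_nbhs_nbhs (conj oU Us).
have W1q q : U q -> 1 = form_lin alpha d (Phi q) (W1 q).
  move=> Uq; have [[x' cx' e] _] := Ud q Uq.
  case: q Uq e => u p' Uq /= e; rewrite -e in Uq *.
  apply: etrans (form_velocity alpha UF (chart_at_atlas y) cx' Uq).
  by rewrite velX; have [-> _] := reebX (phi u x').
have N1 : is_diff q0 (fun q => form_lin alpha d (Phi q) (W1 q)) 0.
  by apply: near_is_diff (is_diff_cst (1 : R^o) q0); apply: filterS nU => q /W1q.
pose e1 : (R^o * 'rV[R]_(n.*2.+1))%type := (1, 0).
pose e2 : (R^o * 'rV[R]_(n.*2.+1))%type := (0, v).
have E1 := etrans (esym (diffE_is e2 N1)) (diffE_is e2 D1).
have D := partial1_is_diff (ex_diff (is_diff_def := D2)).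
have E2 := diffE_is e1 D2.
have sw : 'd W1 q0 e2 = 'd W2 q0 e1 by exact: (schwarz _ _ frm oU (CU 2%N) Us).
have dpos : W1 q0 = X y.
  have [_ vE] := velocity_rep UF (chart_at_dom x) Us.
  exact: etrans (esym vE) (velX u0 x).
have dz : dform alpha y (W1 q0) (W2 q0) = 0 by rewrite dpos; have [_] := reebX y.
have dz' : 'd (fun z => form_lin alpha d z (W2 q0)) (Phi q0) (W1 q0)
    - 'd (fun z => form_lin alpha d z (W1 q0)) (Phi q0) (W2 q0) = 0.
  by rewrite Phi0; exact: dz.
have E1' : form_lin alpha d (Phi q0) ('d W1 q0 e2)
    + 'd (fun z => form_lin alpha d z (W1 q0)) (Phi q0) (W2 q0) = 0 := esym E1.
have E2' : 'd (fun q => form_lin alpha d (Phi q) (W2 q)) q0 e1 =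
    form_lin alpha d (Phi q0) ('d W2 q0 e1)
    + 'd (fun z => form_lin alpha d z (W2 q0)) (Phi q0) (W1 q0) := E2.
have val0 : 'd (fun q => form_lin alpha d (Phi q) (W2 q)) q0 e1 = 0.
  apply: etrans E2' _; apply: etrans E1'; congr (_ + _); last exact: subr0_eq.
  by congr (form_lin alpha d (Phi q0) _).
have nf : \forall u \near (u0 : R^o), form_lin alpha d (Phi (u, p)) (W2 (u, p)) =
    alpha (phi u x) (tangent_map (phi u) x v).
  apply: filterS (near_fst oU Us) => u Uu.
  exact: (esym (form_tangent alpha v UF (chart_at_atlas y) Uu)).
have Df := near_is_diff nf D.
have Df' : differentiable (fun u : R^o =>
    alpha (phi u x) (tangent_map (phi u) x v)) (u0 : R^o) by case: Df.
apply: DeriveDef; first exact: diff_derivable Df'.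
rewrite (deriveE _ Df'); apply: etrans (diffE_is _ Df) _.
by rewrite scale1r; exact: val0.
Qed.

Lemma reeb_pullback (u : R) (x : M) v :
  alpha (phi u x) (tangent_map (phi u) x v) = alpha x v.
Proof.
rewrite (is_derive_0_is_cst u 0 (reeb_pullback_derive x v)).
have [_ -> _ _] := flowX; congr (alpha x _).
have nim : nbhs (chart_map (chart_at x) x) (chart_map (chart_at x) @` chart_dom (chart_at x)).
  apply: open_nbhs_nbhs; split; first exact: chart_im_open.
  by exists x => //; exact: chart_at_dom.
have nE : \forall p \near chart_map (chart_at x) x,
    p = chart_map (chart_at x) (chart_inv (chart_at x) p).
  apply: filterS nim.
  by move=> p [z cz <-]; rewrite chart_mapK.
exact: (diffE_is v (near_is_diff nE (is_diff_id _))).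
Qed.

Lemma tangent_map_comp (f g : M -> M) x v : smooth_map f -> smooth_map g ->
  tangent_map (f \o g) x v = tangent_map f (g x) (tangent_map g x v).
Proof.
move=> sf sg; pose o0 : R^o := 0.
pose c := chart_at x; pose e := chart_at (g x); pose d := chart_at (f (g x)).
have [U [UF Us]] := smooth_familyP sg (I : [set: R^o] o0) (chart_at_atlas x)
  (chart_at_atlas (g x)) (chart_at_dom x) (chart_at_dom (g x)).
have [U' [UF' Us']] := smooth_familyP sf (I : [set: R^o] o0) (chart_at_atlas (g x))
  (chart_at_atlas (f (g x))) (chart_at_dom (g x)) (chart_at_dom (f (g x))).
have [oU Ud _] := UF.
have Dg := partial2_is_diff (smooth_rep_diff UF Us).
have Df := partial2_is_diff (smooth_rep_diff UF' Us').
have eE : local_rep (fun _ : R^o => g) c e (o0, chart_map c x) = chart_map e (g x).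
  by rewrite /local_rep /= chart_mapK//; exact: chart_at_dom.
have Df' := Df; rewrite -eE in Df'.
have D := is_diff_comp Dg Df'.
have nU : \forall p \near chart_map c x, U (o0, p).
  have [[A B] /= [nA nB] AB] := open_nbhs_nbhs (conj oU Us).
  apply: filterS nB => p Bp; apply: AB; split=> //=; exact: nbhs_singleton nA.
have nE : \forall p \near chart_map c x,
    ((fun z => local_rep (fun _ : R^o => f) e d (o0, z)) \o
     (fun z => local_rep (fun _ : R^o => g) c e (o0, z))) p =
    chart_map d ((f \o g) (chart_inv c p)).
  apply: filterS nU => p /Ud[_ /= dg].
  by rewrite /local_rep /= chart_mapK.
have D' := near_is_diff nE D.
have T := diffE_is v D'.
have Tg := diffE_is v Dg.
have Tf := diffE_is (tangent_map g x v) Df.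
apply: etrans T _; apply: etrans (esym Tf) => /=.
have -> : tangent_map g x v =
    'd (local_rep (fun _ : R^o => g) c e) (o0, chart_map c x) (0, v) by exact: Tg.
by rewrite eE.
Qed.

Lemma contactomorphism_comp (f g : M -> M) :
  contactomorphism f -> contactomorphism g -> contactomorphism (f \o g).
Proof.
move=> [sf [f' [sf' [ff' f'f]]] cf] [sg [g' [sg' [gg' g'g]]] cg].
have frm := has_frame_real R.
split.
- exact: (smooth_family_comp frm sf sg).
- exists (g' \o f'); split; first exact: (smooth_family_comp frm sg' sf').
  by split; apply: can_comp.
- by move=> x v; rewrite tangent_map_comp//= -cf -cg.
Qed.

Lemma smooth_member (P : normedModType R) (A : set P) (F : P -> M -> M) (s : P) :
  has_frame P -> smooth_family A F -> A s -> smooth_map (F s).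
Proof.
move=> hP hF As.
apply: (smooth_family_reparam (a := fun _ : R^o => s) (F := F) hP (has_frame_real R) _ _ hF).
  by move=> k; apply: Ck_cst; exact: openT.
by [].
Qed.

Lemma reeb_flow_contact (calpha : contact_form alpha) (u : R) :
  contactomorphism (phi u).
Proof.
have [sphi phi0 phiD velX] := flowX; have [_ _ _ kerE _] := calpha.
have sm u' : smooth_map (phi u').
  exact: (smooth_member (P := R^o) (has_frame_real R) sphi).
split=> // [|x v]; last by rewrite !kerE reeb_pullback.
exists (phi (- u)); split=> //.
have K w : cancel (phi w) (phi (- w)).
  by move=> x; rewrite -[LHS]/((phi (- w) \o phi w) x) -phiD addNr phi0.
by split=> //; rewrite -{2}(opprK u).
Qed.

End ReebFlow.

(** * A smooth step function *)

Section SmoothStep.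
Variable R : realType.

Lemma Ck_inv (V : normedModType R) k (U : set V) (f : V -> R^o) : open U ->
  (forall x, U x -> f x != 0) -> Ck k U f -> Ck k U (fun x => (f x)^-1 : R^o).
Proof.
move=> oU f0; elim: k => [|k IH].
  by move=> hf x Ux; apply: cvgV; [exact: f0|exact: hf].
move=> Hf; have [f1 f2] := Hf; have If := IH (CkW Hf).
apply: (CkS (df := fun x v => - ((f x)^-1 *: ((f x)^-1 *: ('d f x v : R^o)))) oU).
  move=> x Ux; split; first exact: differentiableV (f1 x Ux) (f0 x Ux).
  apply: etrans (diffV (f1 x Ux) (f0 x Ux)) _; rewrite funeqE => v /=.
  by rewrite /GRing.scale /= mulNr mulrA -invfM.
move=> v; have H := CkZ oU If (CkZ oU If (f2 v)).
have N := @Ck_cst R V R^o k U (-1) oU.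
apply: (Ck_eq oU _ (CkZ oU N H)) => x _.
by rewrite /GRing.scale /= mulN1r.
Qed.

(** The functions [x^-n * exp(-1/x)] extended by zero: each is differentiable
    with a derivative in their span, hence all of them are smooth. *)
Definition flat_exp (n : nat) (x : R^o) : R^o :=
  if 0 < x then x^-1 ^+ n * expR (- x^-1) else 0.

Lemma flat_exp_ge0 n x : 0 <= flat_exp n x.
Proof.
by rewrite /flat_exp; case: ifP => // /ltW x0; rewrite mulr_ge0 ?expR_ge0 ?exprn_ge0 ?invr_ge0.
Qed.

Lemma flat_exp_gt0 n x : 0 < x -> 0 < flat_exp n x.
Proof. by move=> x0; rewrite /flat_exp x0 mulr_gt0 ?expR_gt0 ?exprn_gt0 ?invr_gt0. Qed.

Lemma flat_exp_le0 n x : x <= 0 -> flat_exp n x = 0.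
Proof. by rewrite /flat_exp leNgt => /negbTE ->. Qed.

(** From [y ^ (n+2) / (n+2)! <= exp y] at [y = 1 / x]; the square gives both the
    continuity at 0 and a vanishing derivative there. *)
Lemma flat_exp_bound n (x : R) : `|flat_exp n x| <= (n.+2)`!%:R * x ^+ 2.
Proof.
rewrite ger0_norm ?flat_exp_ge0//.
have [x0|x0] := ltP 0 x; last by rewrite flat_exp_le0// mulr_ge0 ?sqr_ge0.
rewrite /flat_exp x0 expRN; set y := x^-1.
have y0 : 0 < y by rewrite invr_gt0.
have f0 : 0 < (n.+2)`!%:R :> R by rewrite ltr0n fact_gt0.
have ey : y ^+ n.+2 / (n.+2)`!%:R <= expR y.
  by apply: le_trans (expR_ge1Dxn n.+1 (ltW y0)); rewrite lerDr.
rewrite ler_pdivrMr ?expR_gt0//.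
apply: le_trans (ler_wpM2l _ ey); last by rewrite mulr_ge0 ?sqr_ge0// ltW.
have -> : x = y^-1 by rewrite invrK.
rewrite le_eqVlt; apply/orP; left; apply/eqP.
rewrite !exprS; field.
by rewrite (gt_eqF f0) (gt_eqF y0).
Qed.

Lemma flat_exp_derive n (x : R) :
  is_derive x (1 : R) (flat_exp n : R -> R) (flat_exp n.+2 x - n%:R * flat_exp n.+1 x).
Proof.
have [x0|x0|x0] := ltgtP x 0.
- rewrite !flat_exp_le0 ?ltW// mulr0 subr0.
  apply: near_eq_is_derive (is_derive_cst (0 : R) x (1 : R)).
  by near=> y; rewrite flat_exp_le0//; apply: ltW; near: y; exact: lt_nbhsl.
- have xn0 : x != 0 by rewrite gt_eqF.
  have Di := is_deriveV xn0 (is_derive_id x 1).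
  have De : is_derive x (1 : R) (fun y : R => expR (- y^-1)) _ :=
    is_derive1_comp (is_derive_expR _) (is_deriveN Di).
  have Dn := is_deriveX n Di.
  have D := is_deriveM Dn De.
  apply: (@near_eq_is_derive _ _ _
      ((fun y : R => y^-1) ^+ n * (fun y : R => expR (- y^-1)))).
    near=> y; rewrite /flat_exp.
    have -> : 0 < y by near: y; exact: lt_nbhsr.
    by rewrite fctE exprfctE.
  apply: is_derive_eq D _.
  rewrite /flat_exp x0 /GRing.scale /= exprfctE !mulr1.
  case: n Dn => [|n] Dn; first by rewrite !exprS !expr0; field.
  rewrite -[(- [eta GRing.inv]) x]/(- x^-1) -[x ^- 2]exprVn /=.
  move: n.+1%:R => N; move: (expR (- x^-1)) => e; move: (x^-1) => u.
  rewrite !(exprSr u); ring.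
- rewrite x0 !flat_exp_le0// mulr0 subr0.
  have L : (fun h : R => h^-1 *: (((flat_exp n : R -> R) \o shift (0 : R)) (h *: (1 : R)) -
      flat_exp n 0)) @ 0^' --> (0 : R).
    apply/cvgr0Pnorm_le => e e0.
    have K0 : 0 < (n.+2)`!%:R :> R by rewrite ltr0n fact_gt0.
    near=> h.
    rewrite /= addr0 (flat_exp_le0 n (lexx 0)) subr0 /GRing.scale /= mulr1 normrM normfV.
    have h0 : h != 0 by near: h; exact: nbhs_dnbhs_neq.
    rewrite ler_pdivrMl ?normr_gt0//; apply: le_trans (flat_exp_bound n h) _.
    rewrite -real_normK ?num_real// expr2 mulrA mulrC ler_wpM2l//.
    rewrite mulrC -ler_pdivlMr//.
    near: h; apply: dnbhs0_le; exact: divr_gt0.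
  by apply: DeriveDef; [apply/cvg_ex; exists 0|exact: cvg_lim L].
Unshelve. all: by end_near. Qed.

Lemma flat_exp_smooth n : Cinf setT (flat_exp n).
Proof.
move=> k; elim: k n => [|k IH] n.
  move=> x _; apply/differentiable_continuous/derivable1_diffP.
  by case: (flat_exp_derive n x).
have dd x := flat_exp_derive n x.
apply: (CkS (df := fun x v : R^o => v *: (flat_exp n.+2 x - n%:R * flat_exp n.+1 x : R^o)) openT).
  move=> x _; have dx : differentiable (flat_exp n : R -> R) x.
    by apply/derivable1_diffP; case: (dd x).
  split; first exact: dx.
  apply: etrans (diff1E dx) _; rewrite derive1E.
  by have [_ ->] := dd x.
move=> v; have N := @Ck_cst R R^o R^o k setT (- n%:R) openT.
have H := CkD openT (IH n.+2) (CkZ openT N (IH n.+1)).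
apply: (Ck_eq openT _ (CkZ openT (@Ck_cst R R^o R^o k setT v openT) H)) => x _.
by rewrite /GRing.scale /= mulNr.
Qed.

Lemma derive_is_diff (f : R^o -> R^o) (x df : R) :
  is_derive x (1 : R) (f : R -> R) df -> is_diff (x : R^o) f (fun h : R^o => h *: (df : R^o)).
Proof.
move=> D; have dx : differentiable (f : R -> R) x.
  by apply/derivable1_diffP; case: D.
apply: DiffDef; first exact: dx.
apply: etrans (diff1E dx) _; rewrite derive1E.
by have [_ ->] := D.
Qed.

Lemma Ck_affine (a b : R) k : Ck k [set: R^o] (fun x : R^o => a * x + b : R^o).
Proof.
have H := CkD openT (CkZ openT (@Ck_cst R R^o R^o k setT a openT) (@Ck_id R R^o k))
   (@Ck_cst R R^o R^o k setT b openT).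
exact: H.
Qed.

Lemma affine_is_derive (a b x : R) :
  is_derive x (1 : R) (fun x : R => a * x + b) a.
Proof.
apply: is_derive_eq (is_deriveD (is_deriveZ a (is_derive_id x 1)) (is_derive_cst b x 1)) _.
by rewrite addr0 /GRing.scale /= mulr1.
Qed.

(** The quotient [f / (f + g)] of flat functions, where [f] vanishes left of
    [1/3] and [g] vanishes right of [2/3]. *)
Lemma smooth_step_exists : exists b b' : R^o -> R^o,
  [/\ Cinf setT b,
      forall x : R, is_derive x (1 : R) (b : R -> R) (b' x),
      forall x, 0 <= b x <= 1,
      (forall x, x <= 3^-1 -> b x = 0) /\ (forall x, 2 / 3 <= x -> b x = 1)
    & forall x, 0 <= b' x /\ (b' x != 0 -> 0 <= x <= 1)].
Proof.
pose f n (x : R^o) := flat_exp n (1 * x + - 3^-1).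
pose g n (x : R^o) := flat_exp n (-1 * x + 2 / 3).
pose D (x : R^o) : R^o := f 0%N x + g 0%N x.
have f0 n x : x <= 3^-1 -> f n x = 0 by move=> h; apply: flat_exp_le0; lra.
have g0 n x : 2 / 3 <= x -> g n x = 0 by move=> h; apply: flat_exp_le0; lra.
have D0 x : 0 < D x.
  have [h|h] := ltP 3^-1 x.
    by apply: ltr_pwDl; [apply: flat_exp_gt0; lra|exact: flat_exp_ge0].
  by apply: ltr_pwDr; [apply: flat_exp_gt0; lra|exact: flat_exp_ge0].
have fC n k : Ck k setT (f n).
  by apply: (Ck_comp (has_frame_real R) openT (U' := setT)) => //;
    [exact: Ck_affine|exact: flat_exp_smooth].
have gC n k : Ck k setT (g n).
  by apply: (Ck_comp (has_frame_real R) openT (U' := setT)) => //;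
    [exact: Ck_affine|exact: flat_exp_smooth].
exists (fun x => (D x)^-1 *: f 0%N x).
exists (fun x => (f 2%N x * g 0%N x + f 0%N x * g 2%N x) / D x ^+ 2); split.
- move=> k; apply: (CkZ openT) => //; apply: (Ck_inv openT) => [x _|].
    by rewrite gt_eqF.
  exact: (CkD openT (fC _ _) (gC _ _)).
- move=> x; have Df : is_derive x (1 : R) (f 0%N : R -> R) (f 2%N x).
    apply: is_derive_eq (is_derive1_comp (flat_exp_derive 0%N _) (affine_is_derive _ _ _)) _.
    by rewrite mul0r subr0 mulr1.
  have Dg : is_derive x (1 : R) (g 0%N : R -> R) (- g 2%N x).
    apply: is_derive_eq (is_derive1_comp (flat_exp_derive 0%N _) (affine_is_derive _ _ _)) _.
    by rewrite mul0r subr0 mulrN1.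
  have Dn0 : D x != 0 by rewrite gt_eqF.
  apply: is_derive_eq (is_deriveM (is_deriveV Dn0 (is_deriveD Df Dg)) Df) _.
  move: Dn0; rewrite /D /GRing.scale /=.
  move: (f 0%N x) (g 0%N x) (f 2%N x) (g 2%N x) => a b a' b' h.
  by field.
- move=> x; have fx := flat_exp_ge0 0 (1 * x + - 3^-1).
  have gx := flat_exp_ge0 0 (-1 * x + 2 / 3).
  rewrite /GRing.scale /= mulrC ler_pdivrMr// mul1r lerDl gx andbT.
  by rewrite divr_ge0// ltW.
- split=> x h; rewrite /GRing.scale /=; first by rewrite f0// mulr0.
  by rewrite /D g0// addr0 mulVf//; move: (D0 x); rewrite /D g0// addr0 => /gt_eqF ->.
- move=> x; split.
    by rewrite divr_ge0 ?sqr_ge0// addr_ge0// mulr_ge0// flat_exp_ge0.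
  move=> nz; apply/andP; split; rewrite leNgt; apply/negP => h; move/eqP: nz; apply.
    by rewrite !f0 ?mul0r ?addr0 ?mul0r//; lra.
  by rewrite !g0 ?mulr0 ?addr0 ?mul0r//; lra.
Qed.

End SmoothStep.

(** * Upper Darboux sums of a maximum over a compact space *)

Section Darboux.
Variables (R : realType) (T : topologicalType).
Hypotheses (T0 : [set: T] !=set0) (cT : compact [set: T]).
Variable G : R -> T -> R.
Hypothesis cG : forall s x, 0 <= s <= 1 ->
  {for (s, x), continuous (fun q : R * T => G q.1 q.2)}.

Lemma uniform_in_parameter_at (s0 e : R) : 0 <= s0 <= 1 -> 0 < e ->
  \forall s \near s0, forall x, `|G s x - G s0 x| <= e.
Proof.
move=> hs0 e0.
have := (@compact_near_coveringP T setT).1 cT R (nbhs s0)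
  (fun s x => `|G s x - G s0 x| <= e) _ _.
move=> H; have {}H : \forall s \near s0, [set: T] `<=` (fun x => `|G s x - G s0 x| <= e).
  apply: H => x0 _.
  have e20 : 0 < e / 2 by rewrite divr_gt0.
  have /cvgr_dist_le /(_ _ e20) [[A B] /= [nA nB] AB] := @cG s0 x0 hs0.
  exists (B, A) => //= -[x s] [Bx As] /=.
  have h1 := AB (s, x) (conj As Bx); have h2 := AB (s0, x) (conj (nbhs_singleton nA) Bx).
  rewrite /= in h1 h2; rewrite distrC (splitr e).
  have -> : G s0 x - G s x = (G s0 x0 - G s x) - (G s0 x0 - G s0 x) by ring.
  exact: le_trans (ler_normB _ _) (lerD h1 h2).
by apply: filterS H => s H x; exact: H.
Qed.

(** Compactness is used twice: for [T] at each parameter, and then for the unit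
    interval of parameters. *)
Lemma uniform_in_parameter (e : R) : 0 < e ->
  exists N : nat, forall s s' : R, 0 <= s <= 1 -> 0 <= s' <= 1 ->
    `|s - s'| <= N.+1%:R^-1 -> forall x, `|G s x - G s' x| <= e.
Proof.
move=> e0; have e20 : 0 < e / 2 by rewrite divr_gt0.
have K : compact `[(0 : R), 1] by exact: segment_compact.
have := (@compact_near_coveringP R `[(0 : R), 1]).1 K nat \oo
  (fun N s' => forall s, 0 <= s <= 1 -> 0 <= s' <= 1 ->
    `|s - s'| <= N.+1%:R^-1 -> forall x, `|G s x - G s' x| <= e) _ _.
move=> H; have [N _ HN] : \forall N \near \oo, `[(0 : R), 1] `<=`
    (fun s' => forall s, 0 <= s <= 1 -> 0 <= s' <= 1 ->
    `|s - s'| <= N.+1%:R^-1 -> forall x, `|G s x - G s' x| <= e).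
  apply: H => s0; rewrite /= in_itv /= => hs0.
  have /nbhs_ballP[r /= r0 hr] := uniform_in_parameter_at hs0 e20.
  have r20 : 0 < r / 2 by rewrite divr_gt0.
  have nN := near_infty_natSinv_lt (PosNum r20).
  exists (ball s0 (r / 2), [set N | N.+1%:R^-1 < r / 2]).
    by split => //; exact: nbhsx_ballx.
  move=> [s' N] /= [bs' hN] s hs hs' ss' x.
  have b's' : ball s0 r s'.
    by apply: le_ball bs'; rewrite ler_pdivrMr// mulr2n mulrDr mulr1 lerDl ltW.
  have bs : ball s0 r s.
    rewrite -ball_normE /= in bs' *.
    have -> : s0 - s = (s0 - s') - (s - s') by ring.
    apply: le_lt_trans (ler_normB _ _) _; rewrite (splitr r).
    by rewrite ltrD// (le_lt_trans ss').
  rewrite (splitr e).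
  have -> : G s x - G s' x = (G s x - G s0 x) - (G s' x - G s0 x) by ring.
  by apply: le_trans (ler_normB _ _) _; rewrite lerD//; [exact: hr|exact: hr].
by exists N => s s' hs hs' ss' x; apply: (HN N) => //=; rewrite in_itv.
Qed.

(* The maximum over [T] is extended by constants to all parameters, so that it
   is continuous on the whole line and hence measurable. *)
Let clamp (s : R) : R := if s <= 0 then 0 else if 1 <= s then 1 else s.

Lemma clamp_itv s : 0 <= clamp s <= 1.
Proof.
rewrite /clamp; case: (leP s 0) => h1; first by rewrite lexx ler01.
by case: (leP 1 s) => h2; rewrite ?lexx ?ler01// (ltW h1) (ltW h2).
Qed.

Lemma clamp_id s : 0 <= s <= 1 -> clamp s = s.
Proof.
move=> /andP[s0 s1]; rewrite /clamp; case: (leP s 0) => h1; first by lra.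
by case: (leP 1 s) => h2 //; lra.
Qed.

Lemma clamp_dist s s' : `|clamp s - clamp s'| <= `|s - s'|.
Proof.
rewrite ler_norml; have := ler_norm (s - s'); have := ler_norm (s' - s).
rewrite (distrC s' s) /clamp; move: `|s - s'| => N.
by case: (leP s 0) => h1; case: (leP 1 s) => h2; case: (leP s' 0) => h3;
  case: (leP 1 s') => h4 k1 k2; apply/andP; split; lra.
Qed.

Lemma sup_attained s : 0 <= s <= 1 ->
  exists c, forall x, `|G s x| <= `|G s c|.
Proof.
move=> hs; have cf : {within [set: T], continuous (fun x => `|G s x|)}.
  apply: continuous_subspaceT => x.
  apply: (@cvg_norm R R _ (nbhs x) _ (fun x => G s x) (G s x)).
  apply: (@continuous_comp T (R * T)%type R (fun x => (s, x)) (fun q => G q.1 q.2)).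
    move=> U [[A B] /= [nA nB] AB].
    by apply: filterS nB => y By; apply: AB; split=> //=; exact: nbhs_singleton nA.
  exact: cG.
have [c _ hc] := compact_EVT_max T0 cT cf.
by exists c => x; apply: hc; rewrite inE.
Qed.

Let c_ s : T := proj1_sig (cid (sup_attained (clamp_itv s))).
Let H s : R := `|G (clamp s) (c_ s)|.

Lemma supP s x : `|G (clamp s) x| <= H s.
Proof. by rewrite /H /c_; case: cid. Qed.

Lemma sup_dist (e s s' : R) : (forall x, `|G (clamp s) x - G (clamp s') x| <= e) ->
  H s <= H s' + e.
Proof.
move=> h; apply: (@le_trans _ _ (`|G (clamp s') (c_ s)| + e)); last by rewrite lerD2r supP.
rewrite -lerBlDl; apply: le_trans (h (c_ s)).
exact: lerB_dist.
Qed.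

Lemma sup_continuous : continuous (H : R -> R).
Proof.
move=> s; apply/cvgrPdist_le => e e0.
have [N hN] := uniform_in_parameter e0.
have d0 : 0 < N.+1%:R^-1 :> R by rewrite invr_gt0.
near=> s'.
have ss' : `|s - s'| <= N.+1%:R^-1.
  by near: s'; move: (@cvg_id _ (nbhs s)) => /cvgr_dist_le; apply.
have A x := hN _ _ (clamp_itv s) (clamp_itv s') (le_trans (clamp_dist _ _) ss') x.
have B x : `|G (clamp s') x - G (clamp s) x| <= e by rewrite distrC.
have h1 := sup_dist A; have h2 := sup_dist B.
rewrite ler_norml; apply/andP; split; lra.
Unshelve. all: by end_near. Qed.

Lemma ereal_sup_GE s : 0 <= s <= 1 ->
  ereal_sup [set (`|G s x| : R)%:E | x in [set: T]] = (H s)%:E.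
Proof.
move=> hs; apply/eqP; rewrite eq_le; apply/andP; split.
  apply: ge_ereal_sup => _ [x _ <-]; rewrite lee_fin.
  by have := supP s x; rewrite clamp_id.
by apply: ereal_sup_ubound; exists (c_ s) => //; rewrite /H clamp_id.
Qed.

Lemma integral_lower (N : nat) (a : nat -> R) (k : nat) :
  (forall i, (i < k)%N -> forall s, i%:R / N.+1%:R <= s < i.+1%:R / N.+1%:R -> a i <= H s) ->
  ((\sum_(i < k) a i / N.+1%:R)%:E <=
   \int[lebesgue_measure]_(s in `[0%R, (k%:R / N.+1%:R)%R[) (H s)%:E)%E.
Proof.
have N0 : 0 < N.+1%:R :> R by rewrite ltr0n.
have mH D : measurable_fun D (fun s => (H s)%:E).
  apply: measurable_funTS; apply/measurable_EFinP.
  exact: continuous_measurable_fun sup_continuous.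
elim: k => [|k IH] ha.
  by rewrite big_ord0 mul0r integral_ge0// => s _; rewrite lee_fin normr_ge0.
have k0 : 0 <= k%:R / N.+1%:R :> R by rewrite divr_ge0.
have kk : k%:R / N.+1%:R < k.+1%:R / N.+1%:R :> R.
  by rewrite ltr_pM2r ?invr_gt0// ltr_nat.
have -> : `[0, (k.+1%:R / N.+1%:R)%R[%classic =
    `[0, (k%:R / N.+1%:R)%R[%classic `|`
    `[(k%:R / N.+1%:R)%R, (k.+1%:R / N.+1%:R)%R[%classic :> set R.
  rewrite -(@itv_bndbnd_setU _ _ _ (BLeft (k%:R / N.+1%:R : R)))//; rewrite bnd_simp//.
  exact: ltW.
rewrite ge0_integral_setU//; last 3 first.
- exact: mH.
- by move=> s _; rewrite lee_fin normr_ge0.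
- apply/disj_setPS => s [] /=; rewrite !in_itv /= => /andP[_ h1] /andP[h2 _].
  by have := lt_le_trans h1 h2; rewrite ltxx.
rewrite big_ord_recr /= EFinD leeD//; first by apply: IH => i ik; apply: ha; exact: ltnW.
apply: (@le_trans _ _ (\int[lebesgue_measure]_(s in
    `[(k%:R / N.+1%:R)%R, (k.+1%:R / N.+1%:R)%R[) (cst (Num.max 0 (a k))%:E s))%E).
  rewrite integral_cst//= lebesgue_measure_itv /= lte_fin kk -EFinB -EFinM lee_fin.
  have -> : k.+1%:R / N.+1%:R - k%:R / N.+1%:R = N.+1%:R^-1 :> R.
    by rewrite -mulrBl -natr1 addrAC subrr add0r mul1r.
  by rewrite ler_pM2r ?invr_gt0// le_max lexx orbT.
apply: ge0_le_integral => //.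
- by move=> s _; rewrite lee_fin le_max lexx.
- exact: mH.
- move=> s /=; rewrite in_itv /= => hs; rewrite lee_fin ge_max normr_ge0 /=.
  exact: (ha k (ltnSn k)).
Qed.

Lemma in_piece (a b s s' : R) : 0 <= a -> a + b <= 1 ->
  a <= s <= a + b -> a <= s' <= a + b ->
  [/\ 0 <= s <= 1, 0 <= s' <= 1 & `|s - s'| <= b].
Proof.
move=> a0 ab /andP[h1 h2] /andP[h3 h4]; split; rewrite ?ler_norml;
  by apply/andP; split; lra.
Qed.

(** The maximum of [|G s x|] over [x] is continuous in [s], so its integral is
    approximated by Riemann sums. A third [e] of the gap below [L] bounds the
    oscillation on each piece; it is lost once in comparing the Riemann sum with
    the integral, and once in passing from sampled values to upper bounds. *)
Lemma upper_sum_lt (L : R) :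
  (\int[lebesgue_measure]_(s in `[0%R, 1%R])
     ereal_sup [set (`|G s x| : R)%:E | x in [set: T]] < L%:E)%E ->
  exists (N : nat) (a : nat -> R),
    (forall i s x, (i < N.+1)%N -> i%:R / N.+1%:R <= s <= i.+1%:R / N.+1%:R ->
       `|G s x| <= a i) /\
    \sum_(i < N.+1) a i / N.+1%:R < L.
Proof.
move=> hL.
have hL' : (\int[lebesgue_measure]_(s in `[0%R, 1%R[) (H s)%:E < L%:E)%E.
  apply: le_lt_trans hL.
  have mH D : measurable_fun D (fun s => (H s)%:E).
    apply: measurable_funTS; apply/measurable_EFinP.
    exact: continuous_measurable_fun sup_continuous.
  apply: (@le_trans _ _ (\int[lebesgue_measure]_(s in `[0%R, 1%R]) (H s)%:E)%E).
    apply: ge0_subset_integral => //; first exact: mH.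
      by move=> s _; rewrite lee_fin normr_ge0.
    by move=> s /=; rewrite !in_itv /= => /andP[-> /ltW].
  rewrite le_eqVlt; apply/orP; left; apply/eqP; apply: eq_integral => s.
  by rewrite inE /= in_itv /= => hs; rewrite ereal_sup_GE.
have I0 : (0 <= \int[lebesgue_measure]_(s in `[0%R, 1%R[) (H s)%:E)%E.
  by apply: integral_ge0 => s _; rewrite lee_fin normr_ge0.
have [J JE] : exists J : R, (\int[lebesgue_measure]_(s in `[0%R, 1%R[) (H s)%:E = J%:E)%E.
  move: hL' I0; case: (\int[_]_(_ in _) _)%E => [J| |] //= _ _.
  by exists J.
rewrite JE lte_fin in hL'.
pose e := (L - J) / 3.
have e0 : 0 < e by rewrite divr_gt0// subr_gt0.
have [N hN] := uniform_in_parameter e0.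
have N0 : 0 < N.+1%:R :> R by rewrite ltr0n.
have piece i (s s' : R) : (i < N.+1)%N -> i%:R / N.+1%:R <= s <= i.+1%:R / N.+1%:R ->
    i%:R / N.+1%:R <= s' <= i.+1%:R / N.+1%:R ->
    [/\ 0 <= s <= 1, 0 <= s' <= 1 & `|s - s'| <= N.+1%:R^-1].
  move=> iN /andP[h1 h2] /andP[h3 h4].
  have i0 : 0 <= i%:R / N.+1%:R :> R by rewrite divr_ge0.
  have i1 : i.+1%:R / N.+1%:R <= 1 :> R by rewrite ler_pdivrMr// mul1r ler_nat.
  have d : i.+1%:R / N.+1%:R = i%:R / N.+1%:R + N.+1%:R^-1 :> R.
    by rewrite -natr1 mulrDl mul1r.
  by apply: (@in_piece (i%:R / N.+1%:R)); rewrite -?d ?h1 ?h2 ?h3 ?h4.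
have mid i : i%:R / N.+1%:R <= (i%:R / N.+1%:R : R) <= i.+1%:R / N.+1%:R.
  by rewrite lexx ler_pM2r ?invr_gt0// ler_nat leqnSn.
exists N, (fun i => H (i%:R / N.+1%:R) + e); split.
  move=> i s x iN hs; have [h1 h2 h3] := piece i s _ iN hs (mid i).
  have A y : `|G (clamp s) y - G (clamp (i%:R / N.+1%:R)) y| <= e.
    by rewrite !clamp_id//; exact: hN.
  apply: le_trans (sup_dist A).
  by have := supP s x; rewrite clamp_id.
have low := @integral_lower N (fun i => H (i%:R / N.+1%:R) - e) N.+1 _.
rewrite divff ?gt_eqF// JE lee_fin in low.
have {}low : \sum_(i < N.+1) (H (i%:R / N.+1%:R) - e) / N.+1%:R <= J.
  apply: low => i iN s /andP[hs1 hs2].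
  have hs : i%:R / N.+1%:R <= s <= i.+1%:R / N.+1%:R by rewrite hs1 ltW.
  have [h1 h2 h3] := piece i _ s iN (mid i) hs.
  rewrite lerBlDr; apply: sup_dist => y.
  by rewrite !clamp_id//; exact: hN.
have sumc c : \sum_(i < N.+1) (H (i%:R / N.+1%:R) + c) / N.+1%:R =
    \sum_(i < N.+1) H (i%:R / N.+1%:R) / N.+1%:R + c.
  under eq_bigr do rewrite mulrDl.
  rewrite big_split /=; congr (_ + _).
  by rewrite sumr_const card_ord -[LHS]mulr_natr divfK// gt_eqF.
rewrite sumc in low; rewrite sumc.
have : 3 * e = L - J by rewrite /e; field.
move: low; lra.
Qed.

End Darboux.

(** * Slowed-down paths and their clocks *)

Section TimeProfile.
Variable R : realType.

Lemma sum_indicator (n j : nat) : (j <= n)%N ->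
  \sum_(i < n) (i < j)%N%:R = j%:R :> R.
Proof.
move=> jn; rewrite -natr_sum; congr (_%:R).
have E k : (\sum_(i < k) (i < j) = minn k j)%N.
  elim: k => [|k IH]; first by rewrite big_ord0 min0n.
  rewrite big_ord_recr /= IH /minn; case: (ltnP k j) => kj /=.
    by case: (ltnP k.+1 j) => // h; lia.
  by case: ltnP => h; lia.
by rewrite E; apply/minn_idPr.
Qed.

(** A slow-down of the unit interval [B] that pauses around each multiple of
    [1/(N+1)], together with a clock [T] that on the [i]-th piece runs [a i]
    times as fast as [B], plus a small constant drift [d]. Pausing makes the
    clock smooth although its rate relative to [B] is a step function. The drift
    is the gap between the sum and [L], so that the clock covers exactly [L]. *)
Lemma profile_exists (N : nat) (a : nat -> R) (L : R) :
  \sum_(i < N.+1) a i / N.+1%:R < L ->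
  exists (B B' T T' : R^o -> R^o) (d e : R),
    [/\ Cinf setT B /\ Cinf setT T,
        forall x : R, is_derive x (1 : R) (B : R -> R) (B' x) /\
                      is_derive x (1 : R) (T : R -> R) (T' x),
        forall x, 0 <= B x <= 1,
        [/\ 0 < d, 0 < e, forall s, s < e -> B s = 0 /\ T s = d * s
          & forall s, 1 - e < s -> B s = 1 /\ T s = L + d * (s - 1)]
      & forall G : R -> R,
          (forall i u, (i < N.+1)%N ->
            i%:R / N.+1%:R <= u <= i.+1%:R / N.+1%:R -> `|G u| <= a i) ->
          forall s, d <= T' s + B' s * G (B s)].
Proof.
move=> aL; have [b [b' [Cb Db b01 [b0 b1] b'P]]] := smooth_step_exists R.
pose n1 : R := N.+1%:R.
have n0 : 0 < n1 by rewrite ltr0n.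
pose d := L - \sum_(i < N.+1) a i / n1.
have d0 : 0 < d by rewrite subr_gt0.
pose u (i : nat) (s : R) : R := n1 * s + - i%:R.
pose sm (c : nat -> R) (s : R^o) : R^o := \sum_(i < N.+1) c i * b (u i s).
have Csm c : Cinf setT (sm c).
  move=> k; apply: Ck_sum => [|i]; first exact: openT.
  have Cu : Ck k setT (fun s : R^o => b (u i s)).
    by apply: (Ck_comp (has_frame_real R) openT (U' := setT)) => //; exact: Ck_affine.
  exact: (CkZ openT (@Ck_cst R R^o R^o k setT (c i) openT) Cu).
have Dsm c x : is_derive x (1 : R) (sm c : R -> R) (\sum_(i < N.+1) c i * (n1 * b' (u i x))).
  have -> : (sm c : R -> R) = \sum_(i < N.+1) (fun s : R => c i * b (u i s)).
    by rewrite funeqE => s; rewrite fct_sumE.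
  apply: is_derive_sum => i.
  apply: is_derive_eq (is_deriveZ (c i) (is_derive1_comp (Db _) (affine_is_derive _ _ _))) _.
  by rewrite /GRing.scale /= (mulrC (b' _)).
exists (sm (fun=> n1^-1)), (fun x => \sum_(i < N.+1) n1^-1 * (n1 * b' (u i x))).
exists (fun s => sm (fun i => a i / n1) s + d * s).
exists (fun x => \sum_(i < N.+1) (a i / n1) * (n1 * b' (u i x)) + d).
have smB s (S : R) : \sum_(i < N.+1) b (u i s) = S -> sm (fun=> n1^-1) s = S / n1.
  by move=> <-; rewrite /sm -mulr_sumr mulrC.
have b_le (j : nat) (s : R) : u j s <= 1 -> forall i : 'I_N.+1, b (u i s) <= (i < j.+1)%N%:R.
  move=> uj i; have [h|h] := ltnP i j.+1; first by have /andP[] := b01 (u i s).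
  rewrite b0// /u; move: uj; rewrite /u.
  have : j%:R + 1 <= i%:R :> R by rewrite natr1 ler_nat.
  by move: (i%:R) (j%:R) (n1 * s) => p q r; lra.
have b_ge (j : nat) (s : R) : 0 <= u j s -> forall i : 'I_N.+1, (i < j)%N%:R <= b (u i s).
  move=> uj i; have [h|h] := ltnP i j; last by have /andP[] := b01 (u i s).
  rewrite b1// /u; move: uj; rewrite /u.
  have : i%:R + 1 <= j%:R :> R by rewrite natr1 ler_nat.
  by move: (i%:R) (j%:R) (n1 * s) => p q r; lra.
exists d, (3 * n1)^-1; split.
- split; first exact: Csm.
  move=> k; apply: (CkD openT); first exact: Csm.
  exact: (CkZ openT (@Ck_cst R R^o R^o k setT d openT) (@Ck_id R R^o k)).
- move=> x; split; first exact: Dsm.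
  apply: is_derive_eq (is_deriveD (Dsm _ x) (is_deriveZ d (is_derive_id x 1))) _.
  by rewrite /GRing.scale /= mulr1.
- move=> x; apply/andP; split.
    apply: sumr_ge0 => i _; rewrite mulr_ge0 ?invr_ge0 ?(ltW n0)//.
    by have /andP[] := b01 (u i x).
  have -> : 1 = \sum_(i < N.+1) n1^-1.
    by rewrite sumr_const card_ord -[RHS]mulr_natr mulVf// gt_eqF.
  apply: ler_sum => i _; rewrite -[leRHS]mulr1 ler_pM2l ?invr_gt0//.
  by have /andP[] := b01 (u i x).
- split=> //; first by rewrite invr_gt0 mulr_gt0.
  + move=> s hs; have z i : b (u i s) = 0.
      apply: b0; rewrite /u; have i0 : 0 <= i%:R :> R by [].
      have : n1 * s < 3^-1.
        have -> : 3^-1 = n1 * (3 * n1)^-1 :> R by field; rewrite gt_eqF.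
        by rewrite ltr_pM2l.
      by move: i0; move: (i%:R) (n1 * s) => p q; lra.
    by rewrite /sm; split; rewrite big1 ?add0r// => i _; rewrite z mulr0.
  + move=> s hs; have o (i : 'I_N.+1) : b (u i s) = 1.
      apply: b1; rewrite /u; have i0 : i%:R + 1 <= n1 :> R by rewrite natr1 ler_nat.
      have : n1 - 3^-1 < n1 * s.
        have -> : n1 - 3^-1 = n1 * (1 - (3 * n1)^-1) :> R by field; rewrite gt_eqF.
        by rewrite ltr_pM2l.
      by move: i0; move: (i%:R) (n1 * s) => p q; lra.
    split.
      rewrite (smB s n1) ?divff ?gt_eqF//.
      by rewrite (eq_bigr (fun=> 1))// sumr_const card_ord.
    rewrite /sm (eq_bigr (fun i : 'I_N.+1 => a i / n1)); last by move=> i _; rewrite o mulr1.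
    by rewrite /d; ring.
- move=> G hG s; rewrite addrAC lerDr mulr_suml -big_split /=.
  apply: sumr_ge0 => i _.
  have [b'0 b'nz] := b'P (u i s).
  have [z|nz] := eqVneq (b' (u i s)) 0; first by rewrite z !mulr0 mul0r addr0.
  have /andP[ui0 ui1] := b'nz nz.
  have GB : `|G (sm (fun=> n1^-1) s)| <= a i.
    apply: hG => //; rewrite (smB s _ erefl); apply/andP; split.
      rewrite ler_pM2r ?invr_gt0// -(sum_indicator (ltnW (ltn_ord i))).
      by apply: ler_sum => j _; exact: b_ge.
    rewrite ler_pM2r ?invr_gt0// -(sum_indicator (ltn_ord i)).
    by apply: ler_sum => j _; exact: b_le.
  have n10 : n1 != 0 by rewrite gt_eqF.
  have -> : a i / n1 * (n1 * b' (u i s)) + n1^-1 * (n1 * b' (u i s)) * G (sm (fun=> n1^-1) s)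
    = b' (u i s) * (a i + G (sm (fun=> n1^-1) s)).
    by move: (G _) (b' _) (a i) => p q r; field.
  rewrite mulr_ge0//; move: GB; rewrite ler_norml => /andP[h _].
  by rewrite -lerBlDl sub0r.
Qed.

End TimeProfile.

(** * The positive loop and its contraction *)

Section GroupPaths.
Variables (R : realType) (n : nat) (M : closedContactManifold R n).
Let frmR := has_frame_real R.
Let frmR2 := has_frame_prod frmR frmR.

Lemma cont0_contactomorphism (f : M -> M) : cont0 f -> contactomorphism f.
Proof.
by move=> [g [_ cg _ <-]]; apply: cg; rewrite /unit_itv /= in_itv /= lexx ler01.
Qed.

Lemma cont0_path (F : R -> M -> M) (s : R) :
  smooth_family (P := R^o) setT F -> (forall u, contactomorphism (F u)) ->
  F 0 = id -> cont0 (F s).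
Proof.
move=> sF cF F0; exists (fun u : R^o => F (u * s)); split.
- apply: (smooth_family_reparam (P := R^o) (a := fun u : R^o => u * s : R^o)
    frmR frmR _ _ sF) => //.
  move=> k; apply: (Ck_eq openT _ (@Ck_affine R s 0 k)) => x _.
  by rewrite addr0 mulrC.
- by move=> u _; exact: cF.
- by rewrite mul0r.
- by rewrite mul1r.
Qed.

Lemma homotopic_refl (f : R -> M -> M) : cpath f -> homotopic f f.
Proof.
move=> [sf cf]; exists (fun q => f q.2); split=> //.
- apply: (smooth_family_reparam (P := R^o) (a := fun q : (R^o * R^o)%type => q.2)
    frmR frmR2 _ _ sf).
    by move=> k; exact: Ck_snd.
  by move=> q [].
- by move=> r s _; exact: cf.
Qed.

(** For gluing the loop: near each time it is a row of one smooth family. *)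
Lemma smooth_family_near (P : normedModType R) (A : set P) (F : P -> M -> M) :
  (forall s, A s -> exists2 F', smooth_family setT F' & \forall u \near s, F u = F' u) ->
  smooth_family A F.
Proof.
move=> h s x c d As ac ad cx dx.
have [F' sF' nF] := h s As.
rewrite (nbhs_singleton nF) in dx.
have [U [oU Us Ud CU]] := sF' s x c d I ac ad cx dx.
pose W := [set u | F u = F' u]^°.
have WE u : W u -> F u = F' u by exact: interior_subset.
have oUW : open (U `&` fst @^-1` W).
  apply: open_setI_preimage => //; first exact: open_interior.
  by move=> q _; exact: cvg_fst.
exists (U `&` fst @^-1` W); split => //.
- by move=> [u p] [Uq /= /WE ->]; exact: (Ud (u, p)).
- move=> k; apply: (Ck_eq oUW (f := fun q => chart_map d (F' q.1 (chart_inv c q.2)))).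
    by move=> [u p] [_ /= /WE ->].
  by apply: Ck_sub (CU k) => q [].
Qed.

End GroupPaths.

Section Construction.
Variables (R : realType) (n : nat) (M : closedContactManifold R n).
Variables (alpha : oneForm M) (X : M -> 'rV[R]_(n.*2.+1)) (phi : R -> M -> M).
Hypotheses (calpha : contact_form alpha) (reebX : reeb_field alpha X)
  (flowX : flow_of X phi).
Variables (f : R -> M -> M) (k : (R^o * R^o)%type -> M -> M) (a L : R).
Hypotheses (sk : smooth_family (@unit_itv R `*` @unit_itv R) k)
  (sf : smooth_family (P := R^o) (@unit_itv R) f)
  (ck : forall r s, unit_itv r -> unit_itv s -> contactomorphism (k (r, s)))
  (k0 : forall s, unit_itv s -> k (0, s) = phi (a - s * L))
  (k1 : forall s, unit_itv s -> k (1, s) = f s)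
  (kl : forall r, unit_itv r -> k (r, 0) = phi a)
  (kr : forall r, unit_itv r -> k (r, 1) = phi (a - L)).
Variables (b B B' T T' : R^o -> R^o) (d e : R).
Hypotheses (Cb : Cinf setT b) (b01 : forall x, 0 <= b x <= 1) (b_0 : b 0 = 0) (b_1 : b 1 = 1).
Hypotheses (CB : Cinf setT B) (CT : Cinf setT T)
  (DB : forall x : R, is_derive x (1 : R) (B : R -> R) (B' x))
  (DT : forall x : R, is_derive x (1 : R) (T : R -> R) (T' x))
  (B01 : forall x, 0 <= B x <= 1)
  (d0 : 0 < d) (e0 : 0 < e)
  (Tl : forall s, s < e -> B s = 0 /\ T s = d * s)
  (Tr : forall s, 1 - e < s -> B s = 1 /\ T s = L + d * (s - 1))
  (TB : forall x s, d <= T' s + B' s * alpha (f (B s) x) (velocity f (B s) x)).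

Let frmR := has_frame_real R.
Let frmR2 := has_frame_prod frmR frmR.
Let sphi : smooth_family (P := R^o) setT phi. Proof. by case: flowX. Qed.
Let phi0 : phi 0 = id. Proof. by case: flowX. Qed.
Let phiD s t : phi s \o phi t = phi (s + t). Proof. by case: flowX. Qed.
Let cphi u : contactomorphism (phi u).
Proof. by apply: (reeb_flow_contact _ reebX flowX calpha); case: calpha. Qed.
Let unit1 : unit_itv (1 : R). Proof. by rewrite /unit_itv /= in_itv /= lexx ler01. Qed.
Let unitP (s : R) : 0 <= s <= 1 -> unit_itv s. Proof. by rewrite /unit_itv /= in_itv. Qed.

(** Time for which the Reeb flow acts after [k]. At [r = 0], where [k] is the
    Reeb flow itself, it undoes the motion of [k] exactly; at [r = 1] it runs on
    the clock [T], which outruns the path [f \o B]. The parameter [h] slows it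
    down uniformly. *)
Definition clock (h : R) (q : (R^o * R^o)%type) : R^o :=
  - a + ((1 - q.1) * (L * B q.2) + q.1 * T q.2) - h * q.2.

(** On three sides of the square this is the flow [phi (- h * s)] or constant;
    on the fourth, [r = 1], it is positive if [h] is small. The
    reparametrisations [b] and [B] keep the arguments of [k] in the unit square
    for all real parameters, so the family is smooth on the whole plane and
    consists of contactomorphisms. *)
Definition reeb_twist (h : R) (q : (R^o * R^o)%type) : M -> M :=
  phi (clock h q) \o k (b q.1, B q.2).

Lemma clock_smooth h : Cinf setT (clock h).
Proof.
move=> j.
have C c := @Ck_cst R _ R^o j [set: (R^o * R^o)%type] c openT.
have S g : Cinf setT g -> Ck j [set: (R^o * R^o)%type] (fun q => g q.2 : R^o).
  by move=> Cg; exact: (Ck_comp frmR openT (fun _ _ => I) (@Ck_snd R R^o R^o j) (Cg j)).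
have P1 : Ck j [set: (R^o * R^o)%type] (fun q => 1 + -1 * q.1 : R^o).
  exact: (CkD openT (C 1) (CkZ openT (C (-1)) (@Ck_fst R R^o R^o j))).
have P2 := CkZ openT P1 (CkZ openT (C L) (S _ CB)).
have P3 := CkZ openT (@Ck_fst R R^o R^o j) (S _ CT).
have P4 := CkZ openT (C (- h)) (@Ck_snd R R^o R^o j).
have P5 := CkD openT (CkD openT (C (- a)) (CkD openT P2 P3)) P4.
apply: (Ck_eq openT _ P5) => q _.
by rewrite /clock /GRing.scale /= mulN1r mulNr.
Qed.

Lemma reeb_twist_smooth h : smooth_family setT (reeb_twist h).
Proof.
apply: (smooth_family_comp frmR2 (F := fun q => phi (clock h q))
  (G := fun q : (R^o * R^o)%type => k (b q.1, B q.2))).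
  exact: (smooth_family_reparam frmR frmR2 (clock_smooth h) (fun _ _ => I) sphi).
apply: (smooth_family_reparam (a := fun q : (R^o * R^o)%type => (b q.1, B q.2))
  frmR2 frmR2 _ _ sk).
  move=> j; apply: (Ck_pair openT).
    exact: (Ck_comp frmR openT (fun _ _ => I) (@Ck_fst R R^o R^o j) (Cb j)).
  exact: (Ck_comp frmR openT (fun _ _ => I) (@Ck_snd R R^o R^o j) (CB j)).
by move=> q _; split; [exact: unitP (b01 _)|exact: unitP (B01 _)].
Qed.

Lemma reeb_twist_contact h q : contactomorphism (reeb_twist h q).
Proof.
apply: contactomorphism_comp; first exact: cphi.
by apply: ck; [exact: unitP (b01 _)|exact: unitP (B01 _)].
Qed.

Lemma reeb_twist_left h r : reeb_twist h (r, 0) = id.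
Proof.
have [B0 T0] := Tl e0; rewrite /reeb_twist /= B0 kl; last exact: unitP (b01 _).
by rewrite phiD /clock /= B0 T0 !mulr0 !addr0 subr0 addNr phi0.
Qed.

Lemma reeb_twist_right h r : reeb_twist h (r, 1) = phi (- h).
Proof.
have [|B1 T1] := Tr (s := 1); first by rewrite ltrBlDr ltrDl.
rewrite /reeb_twist /= B1 kr; last exact: unitP (b01 _).
by rewrite phiD /clock /= B1 T1; congr phi; ring.
Qed.

Lemma reeb_twist_bottom h s : reeb_twist h (0, s) = phi (- (h * s)).
Proof.
rewrite /reeb_twist /= b_0 k0; last exact: unitP (B01 _).
by rewrite phiD /clock /=; congr phi; ring.
Qed.

Lemma reeb_twist_top_early h s : s < e -> reeb_twist h (1, s) = phi ((d - h) * s).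
Proof.
move=> /Tl[B0 T0]; rewrite /reeb_twist /= B0 kl; last exact: unitP (b01 _).
by rewrite phiD /clock /= B0 T0; congr phi; ring.
Qed.

Lemma reeb_twist_top_late s : 1 - e < s -> reeb_twist 0 (1, s) = phi (d * (s - 1)).
Proof.
move=> /Tr[B1 T1]; rewrite /reeb_twist /= B1 kr; last exact: unitP (b01 _).
by rewrite phiD /clock /= B1 T1; congr phi; ring.
Qed.

Lemma reeb_twist_row_smooth h r : smooth_family (P := R^o) setT (fun s => reeb_twist h (r, s)).
Proof.
have Ca : Cinf setT (fun s : R^o => (r : R^o, s)).
  by move=> j; apply: (Ck_pair openT); [apply: Ck_cst; exact: openT|exact: Ck_id].
exact: (smooth_family_reparam frmR2 frmR Ca (fun _ _ => I) (@reeb_twist_smooth h)).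
Qed.

(** The family restricted to the segment from [(r, 0)] to [(r, s)] is a path of
    contactomorphisms from the identity. *)
Lemma reeb_twist_cont0 h r s : cont0 (reeb_twist h (r, s)).
Proof.
apply: (@cont0_path _ _ _ (fun s => reeb_twist h (r, s))); first exact: reeb_twist_row_smooth.
  by move=> u; exact: reeb_twist_contact.
exact: reeb_twist_left.
Qed.

Lemma phi_line_smooth u : smooth_family (P := R^o) setT (fun s => phi (u * s)).
Proof.
apply: (smooth_family_reparam (P := R^o) (a := fun s : R^o => u * s : R^o)
  frmR frmR _ _ sphi) => //.
by move=> j; apply: (Ck_eq openT _ (@Ck_affine R u 0 j)) => x _; rewrite addr0.
Qed.

Lemma phi_cont0 u : cont0 (phi u).
Proof. exact: cont0_path. Qed.

Lemma smooth_sub (A : set R^o) (F : R -> M -> M) :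
  smooth_family (P := R^o) setT F -> smooth_family (P := R^o) A F.
Proof. by move=> sF s x c c' _; exact: sF. Qed.

Lemma phi_line_based u : based_cpath (fun s => phi (u * s)).
Proof.
split; last by rewrite mulr0.
split; first exact: smooth_sub (@phi_line_smooth u).
by move=> s _; exact: phi_cont0.
Qed.

Lemma velocity_phi_line u s x :
  alpha (phi (u * s) x) (velocity (fun s => phi (u * s)) s x) = u.
Proof.
have D : is_diff (s : R^o) (fun s : R^o => u * s : R^o) (fun h : R^o => h *: (u : R^o)).
  by apply: derive_is_diff; apply: is_derive_eq (is_deriveZ u (is_derive_id s 1)) _;
    rewrite /GRing.scale /= mulr1.
have V := @smooth_has_velocity _ _ M setT phi (u * s) x sphi I.
rewrite (has_velocityE (has_velocity_reparam D V)) linearZ /=.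
have [_ _ _ velX] := flowX.
by rewrite velX; have [-> _] := reebX (phi (u * s) x); rewrite /GRing.scale /= mulr1.
Qed.

(** As [phi] is strict, pairing the velocity with [alpha] simply adds the rate of
    the clock to the contribution of the path. *)
Lemma reeb_twist_top_has_velocity h s x :
  exists2 v, has_velocity (fun u => reeb_twist h (1, u) x) s v &
  alpha (reeb_twist h (1, s) x) v =
    T' s - h + B' s * alpha (f (B s) x) (velocity f (B s) x).
Proof.
have [_ _ _ velX] := flowX.
have E u : reeb_twist h (1, u) = phi (clock h (1, u)) \o f (B u).
  by rewrite /reeb_twist /= b_1 k1//; exact: unitP (B01 _).
have Dc : is_diff (s : R^o) (fun u : R^o => clock h (1, u))
    (fun t : R^o => t *: (T' s - h : R^o)).
  apply: derive_is_diff.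
  have -> : (fun u : R^o => clock h (1, u)) = (fun u : R => - a + T u + (- h) * u).
    by rewrite funeqE => u; rewrite /clock /=; ring.
  apply: is_derive_eq (is_deriveD (is_deriveD (is_derive_cst (- a) s 1) (DT s))
    (is_deriveZ (- h) (is_derive_id s 1))) _.
  by rewrite add0r /GRing.scale /= mulr1.
have Vf := @smooth_has_velocity _ _ M (@unit_itv R) f (B s) x sf (unitP (B01 s)).
have Vg := has_velocity_reparam (derive_is_diff (DB s)) Vf.
have V := has_velocity_family (A := setT) sphi I Dc Vg.
have EF : (fun u => reeb_twist h (1, u) x) = (fun u => phi (clock h (1, u)) (f (B u) x)).
  by rewrite funeqE => u; rewrite E.
rewrite -EF in V; refine (ex_intro2 _ _ _ V _).
rewrite E /= linearD linearZ /= velX.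
have [-> _] := reebX (phi (clock h (1, s)) (f (B s) x)).
rewrite (reeb_pullback _ reebX flowX); last by case: calpha.
by rewrite linearZ /= /GRing.scale /= mulr1.
Qed.

Lemma reeb_twist_top_positive h s x : d - h <=
  alpha (reeb_twist h (1, s) x) (velocity (fun u => reeb_twist h (1, u)) s x).
Proof.
have [v V av] := reeb_twist_top_has_velocity h s x.
rewrite (has_velocityE (F := fun u => reeb_twist h (1, u)) V) av addrAC lerD2r.
exact: TB.
Qed.

(** The rows [reeb_twist 0 (1, _)] over consecutive unit intervals fit together to a
    loop, since near the junctions both are the Reeb flow at speed [d]. *)
Definition loop (s : R) : M -> M := reeb_twist 0 (1, s - (Num.floor s)%:~R).

Lemma loop_near (j : int) (u : R) : j%:~R - e < u -> u < j%:~R + 1 -> e <= 1 ->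
  loop u = reeb_twist 0 (1, u - j%:~R).
Proof.
move=> uj uj1 e1; rewrite /loop; have [h|h] := leP j%:~R u.
  have -> // : Num.floor u = j.
  by apply: floor_def; rewrite intrD h uj1.
have -> : Num.floor u = j - 1.
  apply: floor_def; rewrite subrK h andbT intrD rmorphN /=.
  by move: uj e1; move: (j%:~R) => J; lra.
rewrite intrD rmorphN /=; move: uj h; move: (j%:~R) => J uj h.
have -> : reeb_twist 0 (1, u - J) = phi (d * (u - J)).
  by rewrite reeb_twist_top_early ?subr0//; move: e0; lra.
by rewrite reeb_twist_top_late; [congr phi; ring|lra].
Qed.

Lemma loop_itv (s : R) : 0 <= s <= 1 -> loop s = reeb_twist 0 (1, s).
Proof.
move=> /andP[s0]; rewrite le_eqVlt => /orP[/eqP->|s1].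
  by rewrite /loop floor1 subrr reeb_twist_left reeb_twist_right oppr0 phi0.
rewrite /loop; have -> : Num.floor s = 0; last by rewrite subr0.
by apply: floor_def; rewrite s0 /= intrD mulr0z add0r.
Qed.

Lemma loop_positive : e <= 1 -> positive_loop alpha loop.
Proof.
move=> e1.
have nearby (s : R) : \forall u \near s, loop u = reeb_twist 0 (1, u - (Num.floor s)%:~R).
  have fs := floor_itv s; have /andP[f1 f2] := fs.
  near=> u; apply: loop_near => //.
    by near: u; apply: lt_nbhsr; move: e0 f1; lra.
  by near: u; apply: lt_nbhsl; rewrite intrD in f2.
split.
- apply: smooth_family_near => s _.
  exists (fun u => reeb_twist 0 (1, u - (Num.floor s)%:~R)); last exact: nearby.
  have Ca := fun j => @Ck_affine R 1 (- (Num.floor s)%:~R) j.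
  have H := smooth_family_reparam frmR frmR Ca (fun _ _ => I) (@reeb_twist_row_smooth 0 1).
  have -> // : (fun u => reeb_twist 0 (1, u - (Num.floor s)%:~R)) =
     (fun u => reeb_twist 0 (1, 1 * u - (Num.floor s)%:~R)).
  by rewrite funeqE => u; rewrite mul1r.
- move=> s; rewrite /loop floorDrz ?rpred1// floor1 intrD opprD.
  by congr (reeb_twist 0 (1, _)); rewrite addrACA subrr addr0.
- by move=> s; exact: reeb_twist_cont0.
- move=> s x; set z := (Num.floor s)%:~R : R.
  have [v V av] := reeb_twist_top_has_velocity 0 (s - z) x.
  have Ds : is_diff (s : R^o) (fun u : R^o => u - z : R^o) (fun h : R^o => h *: (1 : R^o)).
    apply: derive_is_diff.
    apply: is_derive_eq (is_deriveB (is_derive_id s 1) (is_derive_cst z s 1)) _.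
    by rewrite subr0.
  have [V1 V2] := has_velocity_reparam Ds V.
  have nl : \forall u \near s, reeb_twist 0 (1, u - z) x = loop u x.
    by apply: filterS (nearby s) => u ->.
  have E : loop s x = reeb_twist 0 (1, s - z) x by [].
  have Vl : has_velocity (loop^~ x) s (1 *: v).
    split; first by apply: filterS2 V1 nl => u + <-.
    by apply: near_is_diff V2; apply: filterS nl => u /= ->.
  rewrite (has_velocityE Vl) scale1r E av.
  have := TB x (s - z); rewrite subr0; exact: lt_le_trans.
Unshelve. all: by end_near. Qed.

Lemma loop_contractible : contractible_loop loop.
Proof.
have l0 : loop 0 = id by rewrite loop_itv ?reeb_twist_left// lexx ler01.
exists (fun q : (R^o * R^o)%type => reeb_twist 0 (1 - q.1, q.2)); split.
- have Ca : Cinf setT (fun q : (R^o * R^o)%type => (1 - q.1 : R^o, q.2)).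
    move=> j; apply: (Ck_pair openT); last exact: Ck_snd.
    have C c := @Ck_cst R _ R^o j [set: (R^o * R^o)%type] c openT.
    apply: (Ck_eq openT _ (CkD openT (C 1) (CkZ openT (C (-1)) (@Ck_fst R R^o R^o j)))).
    by move=> q _; rewrite /GRing.scale /= mulN1r.
  exact: (smooth_family_reparam frmR2 frmR2 Ca (fun _ _ => I) (@reeb_twist_smooth 0)).
- by move=> r s _ _; exact: reeb_twist_cont0.
- move=> s us; rewrite l0 subr0 subrr reeb_twist_bottom mul0r oppr0 phi0 loop_itv//.
- move=> r _; rewrite reeb_twist_left reeb_twist_right oppr0 phi0 l0 loop_itv ?lexx ?ler01//.
  by rewrite reeb_twist_right oppr0 phi0.
Qed.

(** Otherwise the flow is constant near [d / 2], against [alpha X = 1]. *)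
Lemma reeb_flow_moves : exists2 h, 0 < h < d & phi h <> id.
Proof.
apply: contrapT => H.
have [x _] := mfd_nonempty M.
have [_ _ _ velX] := flowX.
pose h0 := d / 2.
have h00 : 0 < h0 by rewrite divr_gt0.
have h0d : h0 < d by rewrite ltr_pdivrMr// mulr_natr mulr2n ltrDl.
have nid : \forall u \near h0, phi u = id.
  near=> u; apply: contrapT => phiu; apply: H; exists u => //.
  by apply/andP; split; near: u; [exact: lt_nbhsr|exact: lt_nbhsl].
have nid0 : phi h0 = id := nbhs_singleton nid.
have V : has_velocity (phi^~ x) h0 0.
  split.
    by apply: (filterS _ nid) => u ->; rewrite nid0; exact: chart_at_dom.
  have Z : is_diff (h0 : R^o) (cst (chart_map (chart_at (phi h0 x)) x))
      (fun h : R^o => h *: (0 : 'rV[R]_(n.*2.+1))).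
    by apply: is_diff_eq (is_diff_cst _ (h0 : R^o)) _; rewrite funeqE => h; rewrite scaler0.
  by apply: near_is_diff Z; apply: (filterS _ nid) => u ->; rewrite nid0.
have := has_velocityE V; rewrite velX => X0.
have [] := reebX (phi h0 x); rewrite X0 linear0 => /eqP.
by rewrite eq_sym oner_eq0.
Unshelve. all: by end_near. Qed.

(** With [I] the class of the identity and [F] that of [phi] up to a small time
    [h]: the Reeb flow gives [I <= F], and [F <= I] because the inverse of [F] is
    also represented by the row [r = 1] of the family slowed down by [h], which
    is still nonnegative. *)
Lemma not_orderable : ~ orderable alpha.
Proof.
have [h /andP[h0 hd] phih] := reeb_flow_moves.
move=> [_ anti _].
pose I1 : R -> M -> M := fun=> id.
pose F : R -> M -> M := fun s => phi (h * s).
pose F' : R -> M -> M := fun s => phi (- h * s).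
have bI : based_cpath I1.
  have <- : (fun s => phi (0 * s)) = I1 by rewrite funeqE => s; rewrite mul0r phi0.
  exact: phi_line_based.
have bF : based_cpath F by exact: phi_line_based.
have bF' : based_cpath F' by exact: phi_line_based.
have rI : hclass I1 I1 by split=> //; apply: homotopic_refl; case: bI.
have rF : hclass F F by split=> //; apply: homotopic_refl; case: bF.
have inv s : is_inverse (F s) (F' s).
  by split=> x; [rewrite -[LHS]/((F' s \o F s) x)|rewrite -[LHS]/((F s \o F' s) x)];
    rewrite phiD -mulrDl ?addNr ?subrr mul0r phi0.
have EI : hclass I1 = hclass F.
  apply: anti; [by exists I1|by exists F| |].
  - exists F; split; last first.
      by move=> s x _; rewrite velocity_phi_line ltW.
    split=> //; exists I1, F; split=> //; last by case: rF.
    by split=> //; exists I1.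
  - exists (fun s => reeb_twist h (1, s)); split; last first.
      move=> s x _; apply: le_trans (reeb_twist_top_positive h s x).
      by rewrite subr_ge0 ltW.
    split.
      split; last exact: reeb_twist_left.
      split; first exact: smooth_sub (@reeb_twist_row_smooth h 1).
      by move=> s _; exact: reeb_twist_cont0.
    exists F', I1; split=> //.
      by split=> //; exists F => // s _; exact: inv.
    exists (reeb_twist h); split.
    + by move=> q x c c' _; exact: reeb_twist_smooth.
    + by move=> r s _ _; exact: reeb_twist_cont0.
    + by move=> s _; rewrite reeb_twist_bottom /F' mulNr.
    + by move=> r _; rewrite reeb_twist_left reeb_twist_right /F' mulr0 phi0 mulr1.
have : hclass I1 F by rewrite EI.
move=> [_ [H [_ _ H3 H4]]].
have [_ e1] := H3 1 unit1; have [_ e2] := H4 1 unit1.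
by apply: phih; rewrite -(mulr1 h) -[LHS]/(F 1) -e1 e2.
Qed.

End Construction.

(** * Short Reeb paths *)

(** The theorem for a Reeb path that runs backwards, from time [a] to time
    [a - L], with the length bound replaced by an upper Darboux sum. Fixing the
    direction loses nothing, as a path and its homotopy can be reversed. *)
Lemma short_path_conclusion (R : realType) (n : nat) (M : closedContactManifold R n)
    (alpha : oneForm M) (phi : R -> M -> M) (f : R -> M -> M)
    (k : (R^o * R^o)%type -> M -> M) (a L : R) (N : nat) (c : nat -> R) :
  contact_form alpha -> reeb_flow alpha phi ->
  smooth_family (@unit_itv R `*` @unit_itv R) k ->
  smooth_family (P := R^o) (@unit_itv R) f ->
  (forall r s, unit_itv r -> unit_itv s -> cont0 (k (r, s))) ->
  (forall s, unit_itv s -> k (0, s) = phi (a - s * L) /\ k (1, s) = f s) ->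
  (forall r, unit_itv r -> k (r, 0) = phi a /\ k (r, 1) = phi (a - L)) ->
  (forall i s x, (i < N.+1)%N -> i%:R / N.+1%:R <= s <= i.+1%:R / N.+1%:R ->
     `|alpha (f s x) (velocity f s x)| <= c i) ->
  \sum_(i < N.+1) c i / N.+1%:R < L ->
  ~ orderable alpha /\
  exists g : R -> M -> M, positive_loop alpha g /\ contractible_loop g.
Proof.
move=> calpha [X [reebX flowX]] sk sf c0k ks kr fc cL.
have [b [b' [Cb _ b01 [b_0 b_1] _]]] := smooth_step_exists R.
have b0 : b 0 = 0 by apply: b_0; rewrite invr_ge0.
have b1 : b 1 = 1 by apply: b_1; lra.
have [B [B' [T [T' [d [e [[CB CT] D B01 [d0 e0 Tl Tr] TB]]]]]]] := profile_exists cL.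
have TBx x s : d <= T' s + B' s * alpha (f (B s) x) (velocity f (B s) x).
  by apply: (TB (fun s => alpha (f s x) (velocity f s x))) => i u iN hu; exact: fc.
have ck r s : unit_itv r -> unit_itv s -> contactomorphism (k (r, s)).
  by move=> hr hs; apply: cont0_contactomorphism; exact: c0k.
have k0 s : unit_itv s -> k (0, s) = phi (a - s * L) by move=> /ks[].
have k1 s : unit_itv s -> k (1, s) = f s by move=> /ks[].
have kl r : unit_itv r -> k (r, 0) = phi a by move=> /kr[].
have kR r : unit_itv r -> k (r, 1) = phi (a - L) by move=> /kr[].
have DB x := (D x).1; have DT x := (D x).2.
pose e' := Num.min e 1.
have e'0 : 0 < e' by rewrite lt_min e0 ltr01.
have e'1 : e' <= 1 by rewrite ge_min lexx orbT.
have Tl' s : s < e' -> B s = 0 /\ T s = d * s by rewrite lt_min => /andP[/Tl].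
have Tr' s : 1 - e' < s -> B s = 1 /\ T s = L + d * (s - 1).
  move=> h; apply: Tr; apply: le_lt_trans h.
  by rewrite lerD2l lerN2 ge_min lexx.
split.
  exact: (not_orderable calpha reebX flowX sk sf ck k0 k1 kl kR Cb b01 b0 b1
    CB CT DB DT B01 d0 e'0 Tl' Tr' TBx).
exists (loop phi k a L b B T); split.
  exact: (loop_positive calpha reebX flowX sk sf ck k1 kl kR Cb b01 b1
    CB CT DB DT B01 d0 e'0 Tl' Tr' TBx e'1).
exact: (loop_contractible calpha reebX flowX sk ck k0 kl kR Cb b01 b0
    CB CT B01 e'0 Tl' Tr').
Qed.

Theorem theorem2p2 (R : realType) (n : nat) (M : closedContactManifold R n)
    (alpha : oneForm M) (phi : R -> M -> M)
    (halpha : contact_form alpha) (hphi : reeb_flow alpha phi)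
    (hlt : exists t : R,
       (hofer_norm alpha (flow_lift phi t) < (`|t|)%:E)%E) :
  ~ orderable alpha /\
  exists f : R -> M -> M, positive_loop alpha f /\ contractible_loop f.
Proof.
have [t /ereal_inf_lt[_ [f [[[sf cf] f0] [h [sh ch h01 hlr]]] <-] len]] := hlt.
have sa : smooth_form alpha by case: halpha.
have unitE (s : R) : unit_itv s = (0 <= s <= 1) :> Prop.
  by rewrite /unit_itv /= in_itv.
have cG (s : R) x : 0 <= s <= 1 -> {for (s, x), continuous
    (fun q : R * M => alpha (f q.1 q.2) (velocity f q.1 q.2) : R)}.
  by rewrite -unitE => us; exact: (form_velocity_continuous sa sf us).
have [N [c [fc cL]]] := upper_sum_lt (mfd_nonempty M) (@mfd_compact _ _ M)
  (G := fun s x => alpha (f s x) (velocity f s x)) cG len.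
have [tneg|tpos] := ltP t 0.
  rewrite ltr0_norm// in cL.
  apply: (short_path_conclusion (a := 0) halpha hphi sh sf ch _ _ fc cL).
    by move=> s /h01[-> ->]; split=> //; congr phi; ring.
  by move=> r /hlr[-> ->]; split; congr phi; ring.
rewrite ger0_norm// in cL.
(* For positive [t] the Reeb flow has to be undone while the path is run
   backwards, from [phi t] to the identity. *)
have frmR := has_frame_real R; have frmR2 := has_frame_prod frmR frmR.
have onem (s : R) : unit_itv s -> unit_itv (1 - s).
  by rewrite !unitE => /andP[s0 s1]; rewrite subr_ge0 s1 lerBlDr lerDl.
have Ca : Cinf setT (fun s : R^o => -1 * s + 1 : R^o) by move=> j; exact: Ck_affine.
have Dr (s : R) : is_diff (s : R^o) (fun s : R^o => -1 * s + 1 : R^o)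
    (fun u : R^o => u *: (-1 : R^o)).
  exact: (derive_is_diff (affine_is_derive (-1) 1 s)).
have aff (s : R) : -1 * s + 1 = 1 - s by ring.
pose f' (s : R) := f (-1 * s + 1).
pose h' (q : (R^o * R^o)%type) := h (q.1, -1 * q.2 + 1 : R^o).
have sf' : smooth_family (P := R^o) (@unit_itv R) f'.
  apply: (smooth_family_reparam frmR frmR Ca _ sf) => s us.
  by rewrite aff; exact: onem.
have sh' : smooth_family (@unit_itv R `*` @unit_itv R) h'.
  have Ch : Cinf setT (fun q : (R^o * R^o)%type => (q.1, -1 * q.2 + 1 : R^o)).
    move=> j; apply: (Ck_pair openT); first exact: Ck_fst.
    exact: (Ck_comp frmR openT (fun _ _ => I) (@Ck_snd R R^o R^o j) (Ca j)).
  apply: (smooth_family_reparam frmR2 frmR2 Ch _ sh) => -[r s] [/= ur us].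
  by split=> //=; rewrite aff; exact: onem.
apply: (@short_path_conclusion _ _ M alpha phi f' h' t t N (fun i => c (N - i)%N)) => //.
- by move=> r s ur us; apply: ch => //=; rewrite aff; exact: onem.
- move=> s us; have us' : unit_itv (-1 * s + 1) by rewrite aff; exact: onem.
  by rewrite /h' /=; have [-> ->] := h01 _ us'; split=> //; congr phi; ring.
- move=> r ur; have [l1 l2] := hlr r ur; rewrite /h' /= mulr0 add0r mulN1r addNr.
  by rewrite l1 l2; split; congr phi; ring.
- move=> i s x iN /andP[hs1 hs2].
  have n0 : 0 < N.+1%:R :> R by rewrite ltr0n.
  have NE : N.+1%:R = (N - i)%:R + i.+1%:R :> R by rewrite -natrD; congr (_%:R); lia.
  have NE' : N.+1%:R = (N - i).+1%:R + i%:R :> R by rewrite -natrD; congr (_%:R); lia.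
  have i1 : i.+1%:R / N.+1%:R <= 1 :> R by rewrite ler_pdivrMr// mul1r ler_nat.
  have us : unit_itv s.
    by rewrite unitE; rewrite (le_trans _ hs1) ?divr_ge0// (le_trans hs2).
  have us' : unit_itv (-1 * s + 1) by rewrite aff; exact: onem.
  have V := has_velocity_reparam (Dr s) (smooth_has_velocity (A := @unit_itv R) x sf us').
  rewrite (has_velocityE (F := f') V) scaleN1r linearN normrN.
  apply: fc; first by lia.
  rewrite ler_pdivrMr// ler_pdivlMr//.
  move: hs1 hs2; rewrite ler_pdivrMr// ler_pdivlMr// => hs1 hs2.
  apply/andP; split.
    by move: NE hs2; move: (N.+1%:R) ((N - i)%:R) (i.+1%:R) => p q r; lra.
  by move: NE' hs1; move: (N.+1%:R) ((N - i).+1%:R) (i%:R) => p q r; lra.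
- move: cL; rewrite (reindex_inj rev_ord_inj) /=.
  by under eq_bigr => i _ do rewrite subSS.
Qed.
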